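(* Let $\mathfrak{g}=\mathfrak{gl}(m|n)$ over $\mathbb{C}$, let $G_{\bar 0}=GL_m(\mathbb{C})\times GL_n(\mathbb{C})$ act on $\mathfrak{g}_{\bar 1}$ by the adjoint action (conjugation), and let $\mathcal{N}\subseteq\mathfrak{g}_{\bar 1}$ be the nilpotent cone of $\mathfrak g$. Then: (a) The number of $G_{\bar 0}$-orbits of the adjoint action on $\mathcal{N}$ is finite. (b) The complete set of orbit representatives is given by the matrices $$Y=\left[\begin{array}{c|c}0 & Y^+\\ \hline Y^- & 0\end{array}\right],$$ where $$Y^+=\left[\begin{array}{c|c} I_r & 0\\ \hline 0&0\end{array}\right]\qquad\text{and}\qquad Y^-=\left[\begin{array}{c|ccc} J & C_{r_1} & 0 & 0\\ \hline R_{r_2} & 0&0&0\\ 0&0&I_s&0\\ 0&0&0&0\end{array}\right],\qquad J=\operatorname{diag}(J_1,\dots,J_t).$$ Here $I_r$ (resp. $I_s$) is the $r\times r$ (resp. $s\times s$) identity matrix; $J_1,\dots,J_t$ are Jordan blocks with eigenvalue zero, where $J_i$ is of size $k_i\times k_i$ for $i=1,\dots,t$, with $k_1\ge k_2\ge\dots\ge k_t$ and $r=\sum_{i=1}^t k_i$. Furthermore, the matrices $C_{r_1}$ and $R_{r_2}$ are of size $r\times r_1$ and $r_2\times r$ respectively, and of the form $$C_{r_1}=\begin{pmatrix} e_{i_1}&e_{i_2}&\cdots&e_{i_{r_1}}\end{pmatrix},\qquad R_{r_2}=\begin{pmatrix} e_{j_1}&e_{j_2}&\cdots&e_{j_{r_2}}\end{pmatrix}^T,$$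 where $e_k$ is the column vector (of length $r$) with a single $1$ in the $k$-th row and zeros elsewhere. Each index $i_p$ belongs to the set $\{k_1,\,k_1+k_2,\,\ldots,\,k_1+k_2+\dots+k_t\}$, and each index $j_q$ belongs to the set $\{1,\,1+k_1,\,\ldots,\,1+k_1+\dots+k_{t-1}\}$.
   Context: The Lie superalgebra $\mathfrak{gl}(m|n)$ consists of $(m+n)\times(m+n)$ complex matrices; its even part is the block diagonal matrices $\mathfrak{gl}_m\oplus\mathfrak{gl}_n$, and its odd part $\mathfrak{g}_{\bar 1}$ is the set of matrices $X=\begin{bmatrix}0&X^+\\ X^-&0\end{bmatrix}$ with $X^+$ of size $m\times n$ and $X^-$ of size $n\times m$. The element $(A,B)\in G_{\bar 0}$ acts by $(X^+,X^-)\mapsto (A^{-1}X^+B,\;B^{-1}X^-A)$. The nilpotent cone is $\mathcal{N}=Z\big(S^\bullet(\mathfrak{g}_{\bar 1}^* )^{G_{\bar 0}}_+\big)$, the common zero set in $\mathfrak{g}_{\bar 1}$ of all $G_{\bar 0}$-invariant polynomial functions on $\mathfrak{g}_{\bar 1}$ with zero constant term. Jordan blocks are upper triangular: a Jordan block with eigenvalue zero has $1$'s on the superdiagonal and zeros elsewhere. The parameters are such that the block sizes fit, with $Y^+$ of size $m\times n$ and $Y^-$ of size $n\times m$ (blocks of size zero are omitted).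
   Formalization: The listed matrices Y are not pairwise inequivalent as written; the formal claim is that two of them share an orbit exactly when they agree up to order and repetition of the i_p and of the j_q and permutation of equal-size Jordan blocks. *)

(* Defs.v *)
From HB Require Import structures.
From mathcomp Require Import all_boot all_order all_algebra.
From mathcomp Require Import boolp classical_sets cardinality reals.
From mathcomp Require Import complex.
From mathcomp Require Import mpoly.

Set Implicit Arguments.
Unset Strict Implicit.
Unset Printing Implicit Defensive.

Import GRing.Theory.
Local Open Scope classical_set_scope.
Local Open Scope ring_scope.

Section NilpotentCone.
Variables (F : fieldType) (m n : nat).

(* A matrix of gl(m|n) is [ulsubmx, ursubmx; dlsubmx, drsubmx], so that X^+ is
   ursubmx X and X^- is dlsubmx X. *)
Definition odd_part : set 'M[F]_(m + n) :=
  [set X | ulsubmx X = 0 /\ drsubmx X = 0].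

Definition even_group : set 'M[F]_(m + n) :=
  [set g | exists (A : 'M_m) (B : 'M_n),
     [/\ A \in unitmx, B \in unitmx & g = block_mx A 0 0 B]].

(* The convention g^-1 X g is the one for which (A, B) maps (X^+, X^-) to
   (A^-1 X^+ B, B^-1 X^- A). *)
Definition adj (g X : 'M[F]_(m + n)) : 'M[F]_(m + n) := invmx g *m X *m g.

Definition adj_orbit (X : 'M[F]_(m + n)) : set 'M[F]_(m + n) :=
  [set adj g X | g in even_group].

(* An element of S(g_1^* ) is a polynomial in the m * n entries of X^+ followed
   by the n * m entries of X^-. *)
Definition odd_coord (X : 'M[F]_(m + n)) (i : 'I_(m * n + n * m)) : F :=
  row_mx (mxvec (ursubmx X)) (mxvec (dlsubmx X)) 0 i.

Definition invariant_poly (f : {mpoly F[m * n + n * m]}) : Prop :=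
  forall g X, even_group g -> odd_part X ->
    f.@[odd_coord (adj g X)] = f.@[odd_coord X].

Definition nilcone : set 'M[F]_(m + n) :=
  [set X | odd_part X /\
     forall f : {mpoly F[m * n + n * m]},
       invariant_poly f -> f@_0%MM = 0 -> f.@[odd_coord X] = 0].

End NilpotentCone.

(* Block sizes k_1, ..., k_t; the indices i_1, ..., i_{r_1}; the indices
   j_1, ..., j_{r_2}; and the size s of the second identity block.  The values
   in cind and rind count from 1; positions in the three lists count from 0. *)
Record datum := Datum {
  ksz : seq nat;
  cind : seq nat;
  rind : seq nat;
  sid : nat }.

Section Data.
Variable d : datum.

Definition ksize (l : nat) : nat := nth 0%N (ksz d) l.

Definition rk : nat := (\sum_(l < size (ksz d)) ksize l)%N.

Definition block_end (l : nat) : nat := (\sum_(i < l.+1) ksize i)%N.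
Definition block_start (l : nat) : nat := (1 + \sum_(i < l) ksize i)%N.

(* Repeated indices and arbitrary orderings are allowed in cind and rind. *)
Definition admissible (m n : nat) : Prop :=
  [/\ sorted geq (ksz d) && all (leq 1) (ksz d),
      {subset cind d <= [seq block_end l | l <- iota 0 (size (ksz d))]},
      {subset rind d <= [seq block_start l | l <- iota 0 (size (ksz d))]},
      (rk + size (cind d) + sid d <= m)%N
    & (rk + size (rind d) + sid d <= n)%N].

(* For each Jordan block: its size, whether its last index occurs among the
   i_p, and whether its first index occurs among the j_q. *)
Definition block_types : seq (nat * bool * bool) :=
  [seq (ksize l, block_end l \in cind d, block_start l \in rind d)
  | l <- iota 0 (size (ksz d))].

End Data.

(* Two data differing only by the order and repetitions of the i_p and of the
   j_q, and by a permutation of the Jordan blocks of equal size. *)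
Definition same_up_to_labelling (d d' : datum) : Prop :=
  sid d = sid d' /\ perm_eq (block_types d) (block_types d').

Section Representatives.
Variables (F : fieldType) (m n : nat) (d : datum).

Definition nil_jordan (k : nat) : 'M[F]_k :=
  \matrix_(a < k, b < k) (b == a.+1 :> nat)%:R.

(* e_k, with k counted from 1 *)
Definition ecol (r k : nat) : 'cV[F]_r := \col_(a < r) (a.+1 == k)%:R.

Definition ecols (r : nat) (ks : seq nat) : 'M[F]_(r, size ks) :=
  \matrix_(a < r, p < size ks) ecol r (nth 0%N ks p) a 0.

Definition Jblock : 'M[F]_(rk d) :=
  \mxdiag_(l < size (ksz d)) nil_jordan (ksize d l).

Definition Cblock : 'M[F]_(rk d, size (cind d)) := ecols (rk d) (cind d).

Definition Rblock : 'M[F]_(size (rind d), rk d) := (ecols (rk d) (rind d))^T.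

Definition Yplus : 'M[F]_(m, n) := pid_mx (rk d).

(* conform_mx only transports along
     rk d + (r2 + (s + n')) = n  and  rk d + (r1 + (s + m')) = m,
   which hold for admissible data; its default value 0 is then irrelevant. *)
Definition Yminus : 'M[F]_(n, m) :=
  let r1 := size (cind d) in let r2 := size (rind d) in let s := sid d in
  let m' := (m - (rk d + r1 + s))%N in let n' := (n - (rk d + r2 + s))%N in
  conform_mx 0
    (block_mx Jblock (row_mx Cblock (0 : 'M_(rk d, s + m')))
       (col_mx Rblock (0 : 'M_(s + n', rk d)))
       (block_mx (0 : 'M_(r2, r1)) (0 : 'M_(r2, s + m'))
                 (0 : 'M_(s + n', r1))
                 (block_mx (1%:M : 'M_s) 0 0 (0 : 'M_(n', m'))))).

Definition Yrep : 'M[F]_(m + n) := block_mx 0 Yplus Yminus 0.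

End Representatives.

(* Main.v *)
Require Import Defs.
From HB Require Import structures.
From mathcomp Require Import all_boot all_order all_algebra.
From mathcomp Require Import classical_sets cardinality reals.
From mathcomp Require Import complex.
From mathcomp Require Import mpoly zify.

Set Implicit Arguments.
Unset Strict Implicit.
Unset Printing Implicit Defensive.
Import GRing.Theory.
Local Open Scope ring_scope.

(* In terms of row vectors, an odd matrix X is an endomorphism T of the graded
   space V = C^m + C^n that exchanges the two parities.  If T is nilpotent, then
   V has a homogeneous Jordan basis: lift one of T V and complete it by a
   homogeneous basis of a complement in ker T.  The parities and lengths of its
   chains determine the orbit of X, and they are determined by the dimensions of
   T^k V_e.  A block of size k of the representative, together with the entries
   of C and R attached to it, is one chain of length 2k, 2k+1 or 2k+2; the
   identity block gives chains of length 2, and the remaining basis vectors are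
   chains of length 1.  The coefficients of the characteristic polynomial are
   invariants, so a point X of the nilpotent cone is nilpotent; conversely, c X
   has a Jordan basis of the same type as X when c <> 0, so an invariant is
   constant on the line through X. *)

(** * Graded Jordan bases *)

Section Chains.
Variables (F : fieldType) (V : vectType F).
Implicit Types (T : 'End(V)) (P : bool -> 'End(V)) (U : {vspace V}).
Implicit Types (g : V * (bool * nat)) (s : seq (V * (bool * nat))).

(** Since T exchanges the parities, the difference of dim T^k V_e and dim T^(k+1) V_(1-e) is the
    number of chains of length greater than k whose first vector has parity e; this is why these
    dimensions determine the chain types. A type in turn determines a block: the parity of the first
    vector tells whether R has an entry there, and the remaining length, 2k or 2k+1, gives the size
    and the entry of C. The type of length 2 starting in C^n and the two types of length 1 come from
    no block, so the decoding is unambiguous. The delicate point is that the i_p and the j_q may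
    repeat. A repeated column of C or row of R does not lengthen any chain but adds one of length 1,
    so only distinct indices enter the types of the blocks. *)

Definition chain T g : seq V := [seq iter i T g.1 | i <- iota 0 g.2.2].

Definition chains T s : seq V := flatten [seq chain T g | g <- s].

(** A generator packs a vector with its parity and the length of its chain. Minimality of the length
    is not demanded: it follows once the chains are free. Positivity excludes empty chains, which no
    dimension could detect. *)
Definition chain_gen P T g : bool :=
  [&& P g.2.1 g.1 == g.1, iter g.2.2 T g.1 == 0 & (0 < g.2.2)%N].

Definition jordan_basis P T U s : Prop :=
  all (chain_gen P T) s /\ basis_of U (chains T s).

Lemma chainsP T s x :
  reflect (exists2 g, g \in s & exists2 i, (i < g.2.2)%N & x = iter i T g.1)
          (x \in chains T s).
Proof.
apply: (iffP flatten_mapP) => [[g gs /mapP[i ]]|[g gs [i iL ->]]].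
  by rewrite mem_iota => iL ->; exists g => //; exists i.
by exists g => //; apply: map_f; rewrite mem_iota.
Qed.

Lemma size_chains T s : size (chains T s) = sumn [seq g.2.2 | g <- s].
Proof.
elim: s => //= g s IH.
by rewrite /chains /= size_cat -/(chains T s) IH size_map size_iota.
Qed.

Lemma iter_lfun0 T k : iter k T 0 = 0.
Proof. by elim: k => //= k ->; rewrite linear0. Qed.

Lemma chain_gen_iter0 P T g i :
  chain_gen P T g -> (g.2.2 <= i)%N -> iter i T g.1 = 0.
Proof.
by move=> /and3P[_ /eqP g0 _] /subnK <-; rewrite iterD g0 iter_lfun0.
Qed.

Lemma perm_jordan_basis P T U s s' :
  perm_eq s s' -> jordan_basis P T U s -> jordan_basis P T U s'.
Proof.
move=> ss' [gs bs]; split; first by rewrite -(perm_all _ ss').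
by rewrite -(perm_basis _ (perm_flatten (perm_map (chain T) ss'))).
Qed.

(** The chain vectors can be permuted so that the last vectors of the chains come at the end, and a
    tail of a free sequence is free. *)
Lemma free_chain_ends T s : all (fun g => 0 < g.2.2)%N s ->
  free (chains T s) -> free [seq iter g.2.2.-1 T g.1 | g <- s].
Proof.
move=> s0 frs.
pose r := flatten [seq [seq iter i T g.1 | i <- iota 0 g.2.2.-1] | g <- s].
suff e : perm_eq (chains T s) (r ++ [seq iter g.2.2.-1 T g.1 | g <- s]).
  by apply: (@catr_free _ _ r); rewrite -(perm_free e).
rewrite {frs}/r; elim: s s0 => //= -[v [p [|L]]] s IH //= /IH {}IH.
have E : chain T (v, (p, L.+1)) =
    [seq iter i T v | i <- iota 0 L] ++ [:: iter L T v].
  have := map_cat (fun i => iter i T v) (iota 0 L) (iota (0 + L) 1).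
  by rewrite -iotaD addn1.
rewrite -[chains _ _]/(chain T (v, (p, L.+1)) ++ chains T s) E -!catA perm_cat2l.
rewrite -[iter L T v :: [seq _ | _ <- s]]cat1s.
by rewrite perm_sym perm_catCA perm_sym perm_cat2l.
Qed.
End Chains.

Section Graded.
Variables (F : fieldType) (V : vectType F) (P : bool -> 'End(V)).
Hypothesis PD : forall p v, P p v + P (~~ p) v = v.
Hypothesis PP : forall p v, P p (P p v) = P p v.

Lemma graded_projN p v : P p (P (~~ p) v) = 0.
Proof.
by apply: (addrI (P p v)); rewrite addr0 -{1}(PP p v) -linearD PD.
Qed.

Definition graded (U : {vspace V}) := forall p v, v \in U -> P p v \in U.

(** If a vector lies outside a subspace, so does one of its two homogeneous components; hence
    homogeneous vectors can be added one at a time until [K] is spanned. *)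
Lemma homogeneous_extension (K : {vspace V}) (b : seq V) :
  graded K -> free b -> {subset b <= K} ->
  exists c : seq (V * bool),
    all (fun x => P x.2 x.1 == x.1) c /\ basis_of K (b ++ map fst c).
Proof.
move=> gK; move: {2}(\dim K - size b)%N (leqnn (\dim K - size b)) => N.
elim: N b => [|N IH] b leN frb bK.
  exists [::]; split=> //=; rewrite cats0 basisEfree frb.
  rewrite -subn_eq0 -leqn0 leN andbT; apply/span_subvP; exact: bK.
have sbK : (<<b>> <= K)%VS by apply/span_subvP.
have [Kb|/subvPn[v vK vb]] := boolP (K <= <<b>>)%VS.
  exists [::]; split=> //=; rewrite cats0 /basis_of frb andbT.
  by rewrite eqEsubv sbK.
have [p pb] : exists p, P p v \notin <<b>>%VS.
  have [h|] := boolP (P true v \in <<b>>%VS); last by exists true.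
  exists false; apply: contra vb => h'.
  by rewrite -(PD true v) rpredD.
have frb' : free (b ++ [:: P p v]).
  by rewrite (perm_free (permEl (perm_catC _ _))) /= free_cons pb.
have b'K : {subset b ++ [:: P p v] <= K}.
  by move=> x; rewrite mem_cat inE => /orP[/bK//|/eqP->]; apply: gK.
have szK : (size (b ++ [:: P p v]) <= \dim K)%N.
  rewrite -(eqP (frb' : _ == _)); apply: dimvS; exact/span_subvP.
rewrite size_cat addn1 in szK.
have [|c [hc bc]] := IH _ _ frb' b'K.
  by rewrite size_cat addn1 -ltnS; apply: leq_trans leN; rewrite -subSn ?subSS.
exists ((P p v, p) :: c); split; first by rewrite /= PP eqxx.
by move: bc; rewrite -catA.
Qed.

Lemma jordan_basis_exists (T : 'End(V)) (k : nat) (U : {vspace V}) :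
  (forall p v, T (P p v) = P (~~ p) (T v)) ->
  (T @: U <= U)%VS -> graded U -> {in U, forall v, iter k T v = 0} ->
  exists s, jordan_basis P T U s.
Proof.
move=> TP; elim: k U => [|k IH] U TU gU nU.
  exists [::]; split=> //.
  suff -> : U = 0%VS by exact: nil_basis.
  by apply/eqP; rewrite -subv0; apply/subvP => v /nU /= ->; rewrite mem0v.
have [|||s [gs bs]] := IH (T @: U)%VS.
- exact: limgS.
- move=> p _ /memv_imgP[u uU ->].
  by rewrite -[p]negbK -TP memv_img // gU.
- by move=> _ /memv_imgP[u uU ->]; rewrite -iterSr nU.
(* [lower] removes the first vector of a chain; the lifted generators [s'] are mapped by it to the
   generators [s] of the image. *)
pose lower (g : V * (bool * nat)) := (T g.1, (~~ g.2.1, g.2.2.-1)).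
have [s' [es' gs' Us']] : exists s', [/\ map lower s' = s,
    all (chain_gen P T) s' & all (fun g => g.1 \in U) s'].
  have sW g : g \in s -> g.1 \in (T @: U)%VS.
    move=> gs0; rewrite -(span_basis bs) memv_span //.
    apply/chainsP; exists g => //; exists 0%N => //.
    by case/and3P: (allP gs _ gs0).
  elim: s gs {bs} sW => [|[w [p L]] s IHs] /=; first by exists [::].
  move=> /andP[/and3P[/= /eqP wp /eqP w0 L0] gs sW].
  have [||s' [es' gs' Us']] := IHs => //.
    by move=> g gs0; apply: sW; rewrite inE gs0 orbT.
  have /memv_imgP[u uU /= wu] := sW _ (mem_head _ _).
  (* Only the component of the preimage of parity opposite to [w] is kept; it still maps to [w],
     because [w] is homogeneous. *)
  have Tu : T (P (~~ p) u) = w by rewrite TP negbK -wu.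
  exists ((P (~~ p) u, (~~ p, L.+1)) :: s').
  split; rewrite /= ?gs' ?Us' ?gU //.
    by rewrite /lower /= Tu negbK es'.
  rewrite andbT /chain_gen /= PP eqxx /=.
  by rewrite -iterS iterSr Tu w0 eqxx.
pose ends := [seq iter g.2.2.-1 T g.1 | g <- s'].
have sE g : g \in s' -> (T g.1, (~~ g.2.1, g.2.2.-1)) \in s.
  by move=> gs0; rewrite -es'; apply: (map_f lower gs0).
have s'1 g : g \in s' -> (1 < g.2.2)%N.
  by move=> /sE /(allP gs) /and3P[_ _ /=]; case: (g.2.2) => [|[]].
have ends_free : free ends.
  (* A chain lengthened at its head keeps its last vector. *)
  have -> : ends = [seq iter g.2.2.-1 T g.1 | g <- s].
    rewrite -es' -map_comp; apply/eq_in_map => g /s'1 /=.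
    by case: (g.2.2) => [|[|L]] //= _; rewrite -iterSr.
  apply: free_chain_ends (basis_free bs).
  by apply: sub_all gs => g /and3P[].
have TiU v i : v \in U -> iter i T v \in U.
  by move=> vU; elim: i => //= i; move=> /(memv_img T)/(subvP TU).
have gK : graded (U :&: lker T).
  move=> p v; rewrite !memv_cap !memv_ker => /andP[vU /eqP v0].
  by rewrite gU // TP v0 linear0 eqxx.
have ends_K : {subset ends <= (U :&: lker T)%VS}.
  move=> _ /mapP[g gs0 ->]; rewrite memv_cap memv_ker TiU; last first.
    exact: (allP Us').
  have /= := allP gs' _ gs0; case/and3P=> _ /eqP + g0.
  by rewrite -{1}(prednK g0) /= => ->; rewrite eqxx.
have [c [hc bc]] := homogeneous_extension gK ends_free ends_K.
pose t := [seq (x.1, (x.2, 1%N)) | x <- c].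
have ct : map fst c = chains T t.
  rewrite /t; elim: (c) => //= x c' ->; by [].
have cK x : x \in map fst c -> x \in (U :&: lker T)%VS.
  by move=> xc; rewrite -(span_basis bc) memv_span // mem_cat xc orbT.
have memcat x : (x \in chains T (s' ++ t)) = (x \in chains T s') || (x \in map fst c).
  by rewrite ct /chains map_cat flatten_cat mem_cat.
exists (s' ++ t); split.
  rewrite all_cat gs' /=; apply/allP => _ /mapP[x xc ->].
  rewrite /chain_gen /= (allP hc) //=.
  have : x.1 \in (U :&: lker T)%VS by apply: cK; apply: map_f.
  by rewrite memv_cap memv_ker => /andP[_ ->].
have sU : (<<chains T (s' ++ t)>> <= U)%VS.
  apply/span_subvP => x; rewrite memcat => /orP[|/cK]; last first.
    by rewrite memv_cap => /andP[].
  by case/chainsP => g gs0 [i _ ->]; apply: TiU; apply: (allP Us').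
(* The count is rank-nullity: the lifted chains without their ends are as many as the vectors of
   [chains T s], a basis of the image, and the ends with [c] form a basis of the kernel in [U]. *)
rewrite basisEdim; apply/andP; split; last first.
  have -> : size (chains T (s' ++ t)) = (size (chains T s) + size (ends ++ map fst c))%N.
    rewrite !size_chains size_cat !size_map -es' !map_cat sumn_cat addnA; congr (_ + _)%N.
      have := s'1; elim: (s') => //= g r IHr h.
      rewrite IHr; last by move=> g' g'r; apply: h; rewrite inE g'r orbT.
      have := h g (mem_head _ _); case: (g.2.2) => //= L _.
      by rewrite addSn addnS addnA.
    by rewrite -map_comp; elim: (c) => //= x r ->.
  rewrite -(eqP (basis_free bs)) -(eqP (basis_free bc)).
  by rewrite (span_basis bs) (span_basis bc) addnC limg_ker_dim.
(* The new span already has image [T @: U], so [v] differs from one of its vectors by an element of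
   the kernel. *)
apply/subvP => v vU.
have : T v \in (T @: <<chains T (s' ++ t)>>)%VS.
  apply: subvP (memv_img T vU); rewrite -(span_basis bs).
  apply/span_subvP => x /chainsP[g0]; rewrite -es' => /mapP[g gs0 ->] /= [i iL ->].
  rewrite -iterSr /= memv_img // memv_span // memcat; apply/orP; left.
  apply/chainsP; exists g => //; exists i => //.
  exact: leq_trans iL (leq_pred _).
case/memv_imgP => v' v's Tv.
rewrite -(subrK v' v) rpredD //.
have : v - v' \in (U :&: lker T)%VS.
  by rewrite memv_cap memv_ker linearB /= Tv subrr eqxx andbT rpredB // (subvP sU).
rewrite -(span_basis bc); apply: subvP; apply/span_subvP => x.
rewrite mem_cat => xx; apply: memv_span; rewrite memcat.
case/orP: xx => [|->]; last by rewrite orbT.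
case/mapP => g gs0 ->; apply/orP; left; apply/chainsP; exists g => //.
exists g.2.2.-1 => //; have := s'1 _ gs0; by case: (g.2.2).
Qed.
End Graded.

(** * Recovering the chain types from dimensions *)

Section ChainTypes.

(* The dimension of T^k V_e when t lists the parities and lengths of the chains
   of a Jordan basis: the j-th vector of a chain is T^k of the (j - k)-th one. *)
Definition shifted_count (t : seq (bool * nat)) (e : bool) (k : nat) : nat :=
  sumn [seq count (fun j => (k <= j) && (e == x.1 (+) odd (j + k)))%N (iota 0 x.2)
       | x <- t].

(** T^(k+1) V_(1-e) lies in T^k V_e; the basis vectors lost are the k-th vectors of the chains with
    first parity e, counted from 0. *)
Lemma shifted_count_rec t e k :
  shifted_count t e k =
  (count (fun x => (x.1 == e) && (k < x.2)) t + shifted_count t (~~ e) k.+1)%N.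
Proof.
rewrite /shifted_count; elim: t => //= -[p L] t -> /=.
rewrite [RHS]addnACA; congr (_ + _)%N.
pose A j := (k < j)%N && (~~ e == p (+) odd (j + k.+1)).
(* An index counted on the left is [k] itself, which requires [p = e], or one counted by [A]; the
   two cases are disjoint by [I0]. *)
rewrite (@eq_count _ _ (predU (fun j => (j == k) && (p == e)) A)); last first.
  move=> j /=; rewrite /A leq_eqVlt eq_sym addnS /=.
  case: eqP => [->|_] /=; last by clear A; case: e p (odd _) => [] [] [].
  by rewrite ltnn addnn odd_double addbF orbF eq_sym.
have I0 : count (predI (fun j => (j == k) && (p == e)) A) (iota 0 L) = 0%N.
  rewrite -[RHS](count_pred0 (iota 0 L)); apply: eq_count => j /=.
  by rewrite /A; case: eqP => [->|] //=; rewrite ltnn andbF.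
apply: etrans (esym (addn0 _)) _; rewrite -{2}I0 count_predUI; congr (_ + _)%N.
case: eqP => _ /=; last first.
  by rewrite -[RHS](count_pred0 (iota 0 L)); apply: eq_count => j; rewrite /= andbF.
rewrite (@eq_count _ _ (pred1 k)); last by move=> j /=; rewrite andbT.
by rewrite count_uniq_mem ?iota_uniq // mem_iota.
Qed.

(** The recursion gives the number of chains of each first parity that are longer than k;
    differences in k give the multiplicities. A type of length zero contributes to no count, hence
    the positivity hypotheses. *)
Lemma perm_chain_types t t' :
  all (fun x => 0 < x.2)%N t -> all (fun x => 0 < x.2)%N t' ->
  (forall e k, shifted_count t e k = shifted_count t' e k) -> perm_eq t t'.
Proof.
move=> t0 t'0 e.
have N p k : count (fun x => (x.1 == p) && (k < x.2)%N) t =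
             count (fun x => (x.1 == p) && (k < x.2)%N) t'.
  by have := shifted_count_rec t p k; rewrite !e shifted_count_rec => /addIn.
have M (r : seq (bool * nat)) p k : count (fun x => (x.1 == p) && (k < x.2)%N) r =
   (count_mem (p, k.+1) r + count (fun x => (x.1 == p) && (k.+1 < x.2)%N) r)%N.
  elim: r => //= -[q L] r ->; rewrite addnACA; congr (_ + _)%N.
  rewrite -pair_eqE /= [(k < L)%N]leq_eqVlt [k.+1 == L]eq_sym.
  by case: (q == p) => //=; case: eqP => // ->; rewrite ltnn.
rewrite /perm_eq; apply/allP => -[p [|k]] _ /=.
  rewrite !(count_memPn _) //; apply/negP.
    by move/(allP t'0).
  by move/(allP t0).
apply/eqP; apply: (@addIn (count (fun x => (x.1 == p) && (k.+1 < x.2)%N) t)).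
by rewrite -M {1}N M -N.
Qed.

(** It serves to reorder a second Jordan basis so that its chains match those of the first position
    by position. *)
Lemma perm_map_eq (A B : eqType) (f : A -> B) (s s' : seq A) :
  perm_eq (map f s) (map f s') ->
  exists2 s'', perm_eq s' s'' & map f s'' = map f s.
Proof.
case: s' => [|y0 s'']; first by move=> /perm_nilP e; exists [::].
move: {s''}(y0 :: s'') => s' /(perm_iotaP (f y0))[Is].
rewrite size_map => pI ->; exists [seq nth y0 s' i | i <- Is].
  rewrite perm_sym; apply/(perm_iotaP y0); exists Is => //.
rewrite -map_comp; apply/eq_in_map => i /=.
by rewrite (perm_mem pI) mem_iota => iI; rewrite (nth_map y0).
Qed.
End ChainTypes.

(** * Chain types as a complete invariant *)

Section JordanInvariants.
Variables (F : fieldType) (V : vectType F) (P : bool -> 'End(V)).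
Hypothesis PD : forall p v, P p v + P (~~ p) v = v.
Hypothesis PP : forall p v, P p (P p v) = P p v.

Lemma proj_chain (T : 'End(V)) g q i :
  (forall p v, T (P p v) = P (~~ p) (T v)) -> chain_gen P T g ->
  P q (iter i T g.1) = if q == g.2.1 (+) odd i then iter i T g.1 else 0.
Proof.
move=> TP /and3P[/eqP gp _ _].
have h : P (g.2.1 (+) odd i) (iter i T g.1) = iter i T g.1.
  by elim: i => [|i IH] /=; rewrite ?addbF // addbN -TP IH.
case: eqP => [-> //|/eqP qn].
by rewrite -h; have -> : q = ~~ (g.2.1 (+) odd i); [case: q (_ (+) _) qn => [] []|
   rewrite -{2}[_ (+) _]negbK (graded_projN PD PP)].
Qed.

Lemma free_subseq (X Y : seq V) : subseq X Y -> free Y -> free X.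
Proof.
move=> sXY fY; rewrite (elimT (subseq_uniqP (free_uniq fY)) sXY).
exact: filter_free.
Qed.

Lemma iter_limg_span (T : 'End(V)) k (X : seq V) :
  iter k (lfun_img T) <<X>>%VS = <<map (iter k T) X>>%VS.
Proof.
elim: k => [|k IH] /=; first by rewrite map_id.
by rewrite IH limg_span -map_comp.
Qed.

(** [T] and the projections send every chain vector to a chain vector or to zero, so the image is
    spanned by the part [B] of the basis. *)
Lemma dim_iter_proj (T : 'End(V)) s e k :
  (forall p v, T (P p v) = P (~~ p) (T v)) -> jordan_basis P T fullv s ->
  \dim (iter k (lfun_img T) (P e @: fullv)%VS) = shifted_count (map snd s) e k.
Proof.
move=> TP [gs bs].
pose B := flatten [seq [seq iter j T g.1 | j <- iota 0 g.2.2 &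
                    (k <= j) && (e == g.2.1 (+) odd (j + k))]%N | g <- s].
have frB : free B.
  suff sB : subseq B (chains T s) by exact: free_subseq sB (basis_free bs).
  rewrite /B /chains; elim: (s) => //= g r IH; apply: cat_subseq => //.
  exact: map_subseq (filter_subseq _ _).
have -> : shifted_count (map snd s) e k = size B.
  rewrite /shifted_count /B; elim: (s) => //= g r ->.
  by rewrite size_cat size_map size_filter.
rewrite -(eqP frB) -(span_basis bs) limg_span iter_limg_span -map_comp.
congr (\dim _); apply/eqP; rewrite eqEsubv; apply/andP; split; apply/span_subvP.
  move=> _ /mapP[_ /chainsP[g gs0 [i iL ->]] ->] /=.
  rewrite (proj_chain _ _ TP) ?(allP gs) //.
  case: eqP => [eE|_]; last by rewrite iter_lfun0 mem0v.
  rewrite -iterD; have [ki|ki] := ltnP (k + i) g.2.2; last first.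
    by rewrite (chain_gen_iter0 (allP gs _ gs0) ki) mem0v.
  apply: memv_span; apply/flatten_mapP; exists g => //; apply: map_f.
  rewrite mem_filter leq_addr mem_iota ki !andbT.
  by rewrite addnAC addnn oddD odd_double eE eqxx.
move=> y /flatten_mapP[g gs0 /mapP[j]].
rewrite mem_filter mem_iota => /andP[/andP[kj eE] jL] ->.
apply: memv_span; apply/mapP; exists (iter (j - k) T g.1).
  apply/chainsP; exists g => //; exists (j - k)%N => //.
  exact: leq_ltn_trans (leq_subr _ _) jL.
have -> : e = g.2.1 (+) odd (j - k) by rewrite (eqP eE) oddD oddB.
by rewrite /= (proj_chain _ _ TP) ?(allP gs) // eqxx -iterD subnKC.
Qed.

Lemma jordan_basis_types (T : 'End(V)) s s' :
  (forall p v, T (P p v) = P (~~ p) (T v)) -> 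
  jordan_basis P T fullv s -> jordan_basis P T fullv s' ->
  perm_eq (map snd s) (map snd s').
Proof.
move=> TP js js'; apply: perm_chain_types => [||e k].
- by rewrite all_map; apply: sub_all (js.1) => g /and3P[].
- by rewrite all_map; apply: sub_all (js'.1) => g /and3P[].
- by rewrite -!(dim_iter_proj _ _ TP).
Qed.

(** The map sends one Jordan basis to the other, chain by chain. Surjectivity is recorded in place
    of an inverse, as it makes the associated square matrix invertible. *)
Lemma jordan_basis_conj (T T' : 'End(V)) s s' :
  (forall p v, T (P p v) = P (~~ p) (T v)) ->
  (forall p v, T' (P p v) = P (~~ p) (T' v)) ->
  jordan_basis P T fullv s -> jordan_basis P T' fullv s' ->
  perm_eq (map snd s) (map snd s') ->
  exists h : {linear V -> V}, [/\ forall p v, h (P p v) = P p (h v),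
    forall v, h (T v) = T' (h v) & forall v, exists u, h u = v].
Proof.
move=> TP T'P js js1 /perm_map_eq[s'' ps es].
have {js1 ps} js'' := perm_jordan_basis ps js1; move: s'' js'' es => {}s' [gs' bs'] es.
case: js => gs bs.
have [h hE] := linear_of_free (chains T s) (chains T' s').
have szc : size (chains T' s') = size (chains T s).
  rewrite !size_chains; congr sumn.
  by rewrite (map_comp snd snd s') es -map_comp.
have {hE} hE := hE (basis_free bs) szc.
(* The two flattened lists agree and have the same shape, so they agree chain by chain. *)
have hchain : [seq map h (chain T g) | g <- s] = [seq chain T' g | g <- s'].
  apply: eq_from_flatten_shape.
    by rewrite -[RHS]/(chains T' s') -hE /chains map_flatten -map_comp.
  rewrite /shape -!map_comp.
  rewrite (@eq_map _ _ _ (fun g => g.2.2)); last by move=> g /=; rewrite !size_map size_iota.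
  rewrite [RHS](@eq_map _ _ _ (fun g => g.2.2)); last first.
    by move=> g /=; rewrite !size_map size_iota.
  by rewrite (map_comp snd snd s) -es -map_comp.
(* The formula holds for all [i], also past the end of the chain, where both sides vanish; hence [h]
   commutes with the maps at the last vectors too. *)
have hgen g : g \in s -> exists g', [/\ g' \in s', g'.2 = g.2 &
    forall i, h (iter i T g.1) = iter i T' g'.1].
  move=> gs0; pose j := index g s.
  have js0 : (j < size s)%N by rewrite index_mem.
  have szs : size s' = size s by rewrite -(size_map snd s') es size_map.
  exists (nth g s' j); have g's : nth g s' j \in s' by rewrite mem_nth ?szs.
  have e2 : (nth g s' j).2 = g.2.
    by rewrite -(@nth_map _ g _ g.2 snd j s') ?szs // es (nth_map g) // nth_index.
  split=> // i.
  have [iL|Li] := ltnP i g.2.2; last first.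
    rewrite (chain_gen_iter0 (allP gs _ gs0) Li) linear0.
    by rewrite (chain_gen_iter0 (allP gs' _ g's)) // e2.
  have := congr1 (fun x => nth 0 (nth [::] x j) i) hchain.
  rewrite !(nth_map g) ?szs // nth_index // (nth_map 0) ?size_map ?size_iota //.
  by rewrite !(nth_map 0%N) ?size_iota ?e2 // !nth_iota ?e2 ?add0n.
have ext (f1 f2 : {linear V -> V}) : {in chains T s, f1 =1 f2} -> f1 =1 f2.
  move=> e v; have := memvf v; rewrite -(span_basis bs) => vs.
  rewrite (coord_span (X := in_tuple (chains T s)) vs) !linear_sum.
  apply: eq_bigr => i _; rewrite !linearZ /= e //.
  by rewrite mem_nth.
exists h; split.
- move=> p; apply: (ext (h \o P p) (P p \o h)) => _ /chainsP[g gs0 [i _ ->]] /=.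
  have [g' [g's e2 hi]] := hgen _ gs0.
  rewrite hi (proj_chain _ _ TP) ?(allP gs) // (proj_chain _ _ T'P) ?(allP gs') // e2.
  by case: ifP => // _; rewrite linear0.
- apply: (ext (h \o T) (T' \o h)) => _ /chainsP[g gs0 [i _ ->]] /=.
  have [g' [g's e2 hi]] := hgen _ gs0.
  by rewrite -iterS !hi.
move=> v; have := memvf v; rewrite -(span_basis bs') => vs.
rewrite (coord_span (X := in_tuple (chains T' s')) vs) {vs}.
have S x : x \in chains T' s' -> exists u, h u = x.
  by rewrite -hE => /mapP[u _ ->]; exists u.
have /fin_all_exists [u hu] (i : 'I_(size (chains T' s'))) :
    exists u, h u = (in_tuple (chains T' s'))`_i.
  by apply: S; rewrite mem_nth.
exists (\sum_i coord (in_tuple (chains T' s')) i v *: u i).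
by rewrite linear_sum; apply: eq_bigr => i _; rewrite linearZ /= hu.
Qed.
End JordanInvariants.

(** * Chain types of a datum *)

Section DatumTypes.
Implicit Types (bt : seq (nat * bool * bool)) (t : seq (bool * nat)).

(* Parity [true] is that of C^n.  With row vectors, a block of size k is a chain
   e -> f -> e -> ... -> f of length 2k; an entry of C appends one e at its end
   and an entry of R prepends one f. *)
Definition block_chain (x : nat * bool * bool) : bool * nat :=
  (x.2, (x.1.1).*2 + x.1.2 + x.2)%N.

Definition block_ksize (x : nat * bool * bool) : nat := x.1.1.
Definition block_c (x : nat * bool * bool) : nat := x.1.2.
Definition block_r (x : nat * bool * bool) : nat := x.2.

(** The sums of [block_c] and [block_r] count flagged blocks, that is, distinct indices; repeated
    columns of C and rows of R are thus included among the chains of length 1. *)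
Definition chain_types (m n : nat) bt (s : nat) : seq (bool * nat) :=
  map block_chain bt ++ nseq s (true, 2) ++
  nseq (m - (sumn (map block_ksize bt) + sumn (map block_c bt) + s)) (false, 1%N) ++
  nseq (n - (sumn (map block_ksize bt) + sumn (map block_r bt) + s)) (true, 1%N).

(** The first parity is the flag of R; what remains of the length is 2k plus the flag of C, which is
    read off from its half and its parity. *)
Lemma block_chain_inj : injective block_chain.
Proof.
move=> [[k c] r] [[k' c'] r'] [-> ]; rewrite /= => /addIn e.
have ck (a : nat) (b : bool) : odd (a.*2 + b) = b /\ (a.*2 + b)./2 = a.
  by rewrite oddD odd_double addbC addbF addnC half_bit_double; case: b.
have [o h] := ck k c; have [o' h'] := ck k' c'.
by congr (_, _, _); [rewrite -h e h' | rewrite -o e o'].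
Qed.

(** These are the types of blocks of positive size. The type [(true, 2)] is left out: a block chain
    starting in C^n has length at least 3, so this type belongs to the identity block. *)
Definition long_chain (x : bool * nat) := (2 < x.2)%N || (x == (false, 2)).

Lemma long_block_chain (x : nat * bool * bool) :
  (0 < block_ksize x)%N -> long_chain (block_chain x).
Proof.
case: x => [[[|[|k]] c] r] //= _; rewrite /long_chain /block_chain -pair_eqE /=.
  by case: c r => [] [].
Qed.

Lemma filter_long_chain_types m n bt s : all (fun x => 0 < block_ksize x)%N bt ->
  filter long_chain (chain_types m n bt s) = map block_chain bt.
Proof.
move=> bt0; rewrite /chain_types !filter_cat.
have -> : filter long_chain (map block_chain bt) = map block_chain bt.
  apply/all_filterP; rewrite all_map; apply: sub_all bt0 => x.
  exact: long_block_chain.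
by rewrite !filter_nseq /= cats0.
Qed.

Lemma count2_chain_types m n bt s : all (fun x => 0 < block_ksize x)%N bt ->
  count_mem (true, 2) (chain_types m n bt s) = s.
Proof.
move=> bt0; rewrite /chain_types !count_cat !count_nseq.
rewrite (count_memPn _) ?add0n -?pair_eqE /= ?mul1n ?mul0n ?addn0 //.
apply/mapP => -[x xbt e]; have := long_block_chain (allP bt0 _ xbt).
by rewrite -e.
Qed.

Lemma perm_chain_typesE m n bt s bt' s' :
  all (fun x => 0 < block_ksize x)%N bt -> all (fun x => 0 < block_ksize x)%N bt' ->
  perm_eq (chain_types m n bt s) (chain_types m n bt' s') <->
  s = s' /\ perm_eq bt bt'.
Proof.
move=> bt0 bt0'; split=> [e|[-> e]].
  split; first by rewrite -(count2_chain_types m n s bt0) (permP e) count2_chain_types.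
  apply: (perm_map_inj block_chain_inj).
  by have := perm_filter long_chain e; rewrite !filter_long_chain_types.
rewrite /chain_types !(perm_sumn (perm_map _ e)) perm_cat2r.
exact: perm_map.
Qed.

Lemma shifted_count_cat t t' e k :
  shifted_count (t ++ t') e k = (shifted_count t e k + shifted_count t' e k)%N.
Proof. by rewrite /shifted_count map_cat sumn_cat. Qed.

Lemma shifted_count_perm t t' e k :
  perm_eq t t' -> shifted_count t e k = shifted_count t' e k.
Proof. by move=> p; apply: perm_sumn; apply: perm_map. Qed.

Lemma shifted_count_nseq a x e k :
  shifted_count (nseq a x) e k = (a * shifted_count [:: x] e k)%N.
Proof. by rewrite /shifted_count map_nseq sumn_nseq /= addn0 mulnC. Qed.

Lemma count_parity (L : nat) (b : bool) :
  count (fun j => b == odd j) (iota 0 L) = (L + ~~ b)./2.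
Proof.
elim: L => [|L IH]; first by case: b.
rewrite -addn1 iotaD count_cat IH /= addn0 -addnA.
have [o [h ->]] : exists (o : bool) h, L = (o + h.*2)%N.
  by exists (odd L), L./2; rewrite odd_double_half.
rewrite add0n oddD odd_double addbF oddb; clear IH.
by case: b o => [] [] /=; rewrite ?add0n ?addn0 ?add1n ?addn1 ?addn2 /= ?uphalf_double ?doubleK ?addn1.
Qed.

(** For exponent 0 the vectors of parity [e] are counted: k in each block, and one more for an entry
    of R in C^n or of C in C^m. *)
Lemma shifted_count_blocks bt e :
  shifted_count (map block_chain bt) e 0 =
  (sumn (map block_ksize bt) + sumn (map (if e then block_r else block_c) bt))%N.
Proof.
rewrite /shifted_count; elim: bt => [|[[k c] r] bt /=]; first by case: e.
move->; rewrite [RHS]addnACA; congr (_ + _)%N.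
rewrite (@eq_count _ _ (fun j => (e (+) r) == odd j)); last first.
  by move=> j /=; rewrite addn0; case: e r (odd j) => [] [] [].
rewrite count_parity /block_ksize /block_c /block_r /=.
case: e r c => [] [] [] /=; rewrite ?addn0 ?addn1 ?addn2 /= ?uphalf_double ?doubleK ?addn0 ?addn1 //.
Qed.

Lemma perm_insert (A : eqType) (x : A) (r r1 r2 : seq A) :
  perm_eq r (r1 ++ r2) -> perm_eq (x :: r) (r1 ++ x :: r2).
Proof.
by move=> e; rewrite perm_sym -[x :: r2]cat1s perm_catCA perm_cons perm_sym.
Qed.

Lemma long_chain_decomposition t : all (fun x => 0 < x.2)%N t ->
  perm_eq t (filter long_chain t ++ nseq (count_mem (true, 2) t) (true, 2) ++
    nseq (count_mem (false, 1%N) t) (false, 1%N) ++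
    nseq (count_mem (true, 1%N) t) (true, 1%N)).
Proof.
elim: t => //= -[p [|[|[|L]]]] t IH //= /IH {}IH.
- case: p => /=; rewrite -?pair_eqE /= ?add0n ?add1n /long_chain /=.
    by do 2!rewrite catA; apply: perm_insert; rewrite -!catA.
  by rewrite catA; apply: perm_insert; rewrite -!catA.
- case: p => /=; rewrite -?pair_eqE /= ?add0n ?add1n /long_chain /=.
    exact: perm_insert.
  by rewrite perm_cons.
- by rewrite -?pair_eqE /= ?andbF ?add0n /long_chain /= perm_cons.
Qed.
End DatumTypes.

(** * From chain types back to data *)

Section DatumBlocks.
Implicit Type d : datum.

Definition block_pos d (l : nat) : nat := (\sum_(i < l) ksize d i)%N.

Lemma block_posS d l : block_pos d l.+1 = (block_pos d l + ksize d l)%N.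
Proof. by rewrite /block_pos big_ord_recr. Qed.

Lemma block_endE d l : block_end d l = block_pos d l.+1. Proof. by []. Qed.

Lemma block_startE d l : block_start d l = (block_pos d l).+1. Proof. by []. Qed.

Lemma leq_block_pos d l l' : (l <= l')%N -> (block_pos d l <= block_pos d l')%N.
Proof.
move=> /subnK <-; elim: (l' - l)%N => //= j IH.
by rewrite addSn block_posS (leq_trans IH) ?leq_addr.
Qed.

Lemma ltn_block_pos d l l' : all (leq 1) (ksz d) ->
  (l < l')%N -> (l < size (ksz d))%N -> (block_pos d l < block_pos d l')%N.
Proof.
move=> k1 ll' ls; apply: leq_trans (leq_block_pos d ll').
by rewrite block_posS -addn1 leq_add2l (allP k1) ?mem_nth.
Qed.

Lemma block_pos_inj d l l' : all (leq 1) (ksz d) ->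
  (l <= size (ksz d))%N -> (l' <= size (ksz d))%N ->
  block_pos d l = block_pos d l' -> l = l'.
Proof.
move=> k1 ls ls' e; case: (ltngtP l l') => // h.
  by have := ltn_block_pos k1 h (leq_trans h ls'); rewrite e ltnn.
by have := ltn_block_pos k1 h (leq_trans h ls); rewrite e ltnn.
Qed.

Lemma rk_block_pos d : rk d = block_pos d (size (ksz d)). Proof. by []. Qed.

Lemma rk_sumn d : rk d = sumn (ksz d).
Proof. by rewrite sumnE (big_nth 0%N) big_mkord. Qed.

Lemma block_types_ksize d : map block_ksize (block_types d) = ksz d.
Proof. by rewrite /block_types -map_comp; exact: (mkseq_nth 0%N (ksz d)). Qed.

Lemma block_types_gt0 d :
  all (leq 1) (ksz d) -> all (fun x => 0 < block_ksize x)%N (block_types d).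
Proof. by rewrite -{1}(block_types_ksize d) all_map. Qed.

(** [block_end] and [block_start] depend on the block sizes alone, so the auxiliary [d] may carry
    empty index lists. *)
Definition datum_of_blocks (bt : seq (nat * bool * bool)) (s : nat) : datum :=
  let ks := map block_ksize bt in
  let x l := nth (0%N, false, false) bt l in
  let d := Datum ks [::] [::] 0 in
  Datum ks [seq block_end d l | l <- iota 0 (size bt) & (x l).1.2]
           [seq block_start d l | l <- iota 0 (size bt) & (x l).2] s.

Lemma sumn_filter_iota (bt : seq (nat * bool * bool)) (f : nat * bool * bool -> bool) :
  size [seq l <- iota 0 (size bt) | f (nth (0%N, false, false) bt l)] =
  sumn (map (fun x => f x : nat) bt).
Proof.
rewrite size_filter -[bt in RHS](mkseq_nth (0%N, false, false)) /mkseq -map_comp.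
by elim: (iota _ _) => //= l r ->.
Qed.

Lemma datum_of_blocks_types bt s : all (fun x => 0 < block_ksize x)%N bt ->
  block_types (datum_of_blocks bt s) = bt.
Proof.
move=> bt0; rewrite -[RHS](mkseq_nth (0%N, false, false)) /block_types /= size_map.
have k1 : all (leq 1) (ksz (datum_of_blocks bt s)) by rewrite all_map.
apply/eq_in_map => l; rewrite mem_iota /= add0n => ls.
rewrite [RHS]surjective_pairing [(nth _ bt l).1]surjective_pairing.
congr (_, _, _).
- by rewrite /ksize /= (nth_map (0%N, false, false)).
- apply/mapP/idP => [[l']|h]; last first.
    by exists l => //; rewrite mem_filter h mem_iota.
  rewrite mem_filter mem_iota /= add0n => /andP[c ls'] e.
  have [-> //] : l.+1 = l'.+1.
  by apply: (block_pos_inj k1 _ _ e); rewrite size_map.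
- apply/mapP/idP => [[l']|h]; last first.
    by exists l => //; rewrite mem_filter h mem_iota.
  rewrite mem_filter mem_iota /= add0n => /andP[c ls'] [e].
  suff -> : l = l' by [].
  by apply: (block_pos_inj k1 _ _ e); rewrite size_map ltnW.
Qed.

Lemma datum_of_chain_types m n (t : seq (bool * nat)) :
  all (fun x => 0 < x.2)%N t -> shifted_count t false 0 = m ->
  shifted_count t true 0 = n ->
  exists2 d, admissible d m n &
    perm_eq t (chain_types m n (block_types d) (sid d)).
Proof.
move=> t0 tm tn.
(* This is the inverse of [block_chain] on long types: the flag of R is subtracted from the length,
   which leaves 2k plus the flag of C. *)
pose dec (x : bool * nat) := ((x.2 - x.1)./2, odd (x.2 - x.1), x.1).
have decK : {in long_chain, cancel dec block_chain}.
  move=> [p L]; rewrite unfold_in /long_chain /block_chain /dec /= => h.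
  congr (_, _); rewrite [((_)./2.*2 + _)%N]addnC odd_double_half subnK //.
  by case: p h; case: L => [|[]].
have dec0 x : long_chain x -> (0 < block_ksize (dec x))%N.
  case: x => p L; rewrite /long_chain /dec /block_ksize /=.
  by case: p => /=; rewrite -?pair_eqE /= ?orbF; case: L => [|[|[|L]]] //= _; rewrite subSS.
pose leT (x y : nat * bool * bool) := (block_ksize y <= block_ksize x)%N.
pose bt := sort leT (map dec (filter long_chain t)).
pose s := count_mem (true, 2) t.
have bt0 : all (fun x => 0 < block_ksize x)%N bt.
  rewrite (perm_all _ (permEl (perm_sort _ _))) all_map; apply/allP => x.
  by rewrite mem_filter => /andP[/dec0].
have pbt : perm_eq (map block_chain bt) (filter long_chain t).
  apply: perm_trans (perm_map _ (permEl (perm_sort _ _))) _.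
  rewrite -map_comp map_id_in // => x; rewrite mem_filter => /andP[h _].
  exact: decK.
have pt := long_chain_decomposition t0.
(* For the two parities the left side is [m] and [n]. This yields both size bounds of admissibility
   and the numbers of chains of length 1. *)
have cnt e : shifted_count t e 0 = (sumn (map block_ksize bt) +
    sumn (map (if e then block_r else block_c) bt) + s +
    count_mem (e, 1%N) t)%N.
  rewrite (shifted_count_perm _ _ pt) !shifted_count_cat !shifted_count_nseq.
  rewrite -(shifted_count_perm _ _ pbt) shifted_count_blocks -!addnA.
  by case: e; rewrite /shifted_count /= !addn0 ?muln1 ?muln0 ?addn0 ?add0n.
pose d := datum_of_blocks bt s.
have szc : size (cind d) = sumn (map block_c bt).
  by rewrite /= size_map (sumn_filter_iota bt (fun x => x.1.2)).
have szr : size (rind d) = sumn (map block_r bt).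
  by rewrite /= size_map (sumn_filter_iota bt (fun x => x.2)).
exists d; last first.
  rewrite datum_of_blocks_types // /chain_types -tm -tn !cnt !addKn.
  by apply: perm_trans pt _; rewrite perm_cat2r perm_sym.
split.
- apply/andP; split; last by rewrite all_map.
  rewrite /= sorted_map; apply: sort_sorted => x y; exact: leq_total.
- rewrite /= size_map => x /mapP[l]; rewrite mem_filter => /andP[_ h] ->.
  exact: map_f.
- rewrite /= size_map => x /mapP[l]; rewrite mem_filter => /andP[_ h] ->.
  exact: map_f.
- by rewrite rk_sumn szc -tm cnt leq_addr.
- by rewrite rk_sumn szr -tn cnt leq_addr.
Qed.
End DatumBlocks.

(** * Jordan bases of the representatives *)

Section ParityAction.
Variables (F : fieldType) (m n : nat).

Definition parity_mx (p : bool) : 'M[F]_(m + n) :=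
  if p then block_mx 0 0 0 1%:M else block_mx 1%:M 0 0 0.

Definition mulr_end (X : 'M[F]_(m + n)) : 'End('rV[F]_(m + n)) := linfun (mulmxr X).

Definition parity_end (p : bool) := mulr_end (parity_mx p).

Lemma mulr_endE X v : mulr_end X v = v *m X. Proof. by rewrite lfunE. Qed.

Lemma parity_endE p (v : 'rV[F]_m) (w : 'rV[F]_n) :
  parity_end p (row_mx v w) = if p then row_mx 0 w else row_mx v 0.
Proof.
rewrite mulr_endE /parity_mx; case: p; rewrite mul_row_block;
by rewrite !mulmx0 !mulmx1 ?addr0 ?add0r.
Qed.

Lemma parity_endD p v : parity_end p v + parity_end (~~ p) v = v.
Proof.
rewrite -[v]hsubmxK !parity_endE.
by case: p => /=; rewrite add_row_mx ?addr0 ?add0r.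
Qed.

Lemma parity_endK p v : parity_end p (parity_end p v) = parity_end p v.
Proof. by rewrite -[v]hsubmxK; case: p; rewrite !parity_endE. Qed.

Lemma odd_partP (X : 'M[F]_(m + n)) :
  odd_part X <-> X = block_mx 0 (ursubmx X) (dlsubmx X) 0.
Proof.
split=> [[h1 h2]|->]; first by rewrite -{1}(submxK X) h1 h2.
by split; rewrite ?block_mxKul ?block_mxKdr.
Qed.

Lemma mulr_end_parity X p v : odd_part X ->
  mulr_end X (parity_end p v) = parity_end (~~ p) (mulr_end X v).
Proof.
move=> /odd_partP ->; rewrite -[v]hsubmxK [X in parity_end (~~ p) X]mulr_endE.
rewrite mul_row_block !parity_endE mulr_endE.
by case: p => /=; rewrite mul_row_block ?mul0mx ?mulmx0 ?addr0 ?add0r.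
Qed.
End ParityAction.

(** * Entries of the representatives *)

Section RepresentativeEntries.
Variable F : fieldType.

(* Zero when [k <= a]. *)
Definition unit_row k (a : nat) : 'rV[F]_k := \row_j (j == a :> nat)%:R.

Lemma unit_row_mul k k' (M : 'M[F]_(k, k')) (i : 'I_k) : unit_row k i *m M = row i M.
Proof.
rewrite rowE; congr (_ *m _); apply/rowP => j; rewrite !mxE eqxx /=.
by rewrite -val_eqE.
Qed.

Lemma unit_row_oversize k a : (k <= a)%N -> unit_row k a = 0.
Proof.
by move=> ka; apply/rowP => j; rewrite !mxE ltn_eqF // (leq_trans (ltn_ord j)).
Qed.

Lemma conform_mxE m n m' n' (A : 'M[F]_(m', n')) (B : 'M[F]_(m, n))
    (em : m = m') (en : n = n') i j :
  conform_mx A B i j = B (cast_ord (esym em) i) (cast_ord (esym en) j).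
Proof.
case: m' / em A i => A i; case: n' / en A j => A j.
by rewrite conform_mx_id !cast_ord_id.
Qed.

Variable d : datum.
Let t := size (ksz d).

Lemma block_interior l x :
  (block_pos d l < x)%N -> (x < block_pos d l.+1)%N ->
  x \notin [seq block_end d l | l <- iota 0 t].
Proof.
move=> h1 h2; apply/mapP => -[l' _]; rewrite block_endE => e.
have [ll'|ll'] := leqP l l'.
  by have := leq_block_pos d (ll' : l.+1 <= l'.+1)%N; rewrite -e leqNgt h2.
by have := leq_block_pos d ll'; rewrite -e leqNgt h1.
Qed.

Lemma tagnat_block_pos (s : 'I_(rk d)) : exists l i : nat,
  [/\ (l < t)%N, (i < ksize d l)%N & s = (block_pos d l + i)%N :> nat].
Proof.
exists (tagnat.sig1 s), (tagnat.sig2 s); split; rewrite ?ltn_ord //.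
rewrite [LHS]tagnat.rect; congr (_ + _)%N.
by rewrite /block_pos (big_ord_widen t) // ltnW.
Qed.

Lemma Jblock_entry (b a : 'I_(rk d)) :
  Jblock F d b a = ((a == b.+1 :> nat) &&
    (b.+1 \notin [seq block_end d l | l <- iota 0 t]))%:R.
Proof.
rewrite /Jblock /mxdiag mxE.
have rectE (s : 'I_(rk d)) : s = (block_pos d (tagnat.sig1 s) + tagnat.sig2 s)%N :> nat.
  rewrite [LHS]tagnat.rect; congr (_ + _)%N.
  by rewrite /block_pos (big_ord_widen t) // ltnW.
have hb := rectE b; have ha := rectE a.
move: (tagnat.sig2 b) (tagnat.sig2 a) ha hb.
move: (tagnat.sig1 b) (tagnat.sig1 a) => l l' i i' ha hb.
case: eqVneq => [ell|nll].
  subst l'; rewrite conform_mx_id mxE ha hb -addnS eqn_add2l.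
  case: eqP => //= e; rewrite (@block_interior l) //.
    by rewrite -[X in (X < _)%N]addn0 ltn_add2l.
  by rewrite block_posS ltn_add2l -e ltn_ord.
(* If [a = b.+1] lies in another block, then [b] is the last index of its own block. *)
rewrite mxE; case: eqP => //= e; rewrite (_ : _ \notin _ = false) //.
apply/negbF/mapP; exists (l : nat); first by rewrite mem_iota /=.
have iL := ltn_ord i; have iL' := ltn_ord i'.
rewrite block_endE; apply/eqP; rewrite eqn_leq.
have -> /= : (b < block_pos d l.+1)%N by rewrite hb block_posS ltn_add2l.
have [ll'|ll'] := ltnP l l'.
  by rewrite -e ha (leq_trans (leq_block_pos d ll')) ?leq_addr.
have {}ll' : (l' < l)%N by rewrite ltn_neqAle ll' andbT eq_sym.
have := leq_block_pos d ll'; rewrite block_posS leqNgt => /negP[].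
apply: leq_ltn_trans (_ : a < _)%N; last by rewrite ha ltn_add2l.
by rewrite e hb -addnS (leq_trans _ (leq_addr _ _)) // ltnW.
Qed.

(** In the last branch the diagonal of the identity block is written with sums, to avoid truncated
    subtraction; on these rows the equation forces [a] to be at least [rk d + size (cind d)]. *)
Definition Yminus_entry (b a : nat) : bool :=
  if (b < rk d)%N then
    if (a < rk d)%N then
      (a == b.+1) && (b.+1 \notin [seq block_end d l | l <- iota 0 t])
    else (a < rk d + size (cind d))%N && (b.+1 == nth 0%N (cind d) (a - rk d))
  else if (b < rk d + size (rind d))%N then
    (a < rk d)%N && (a.+1 == nth 0%N (rind d) (b - rk d))
  else (b < rk d + size (rind d) + sid d)%N &&
       (a + size (rind d) == b + size (cind d)).

Lemma Yminus_entryE m n (b : 'I_n) (a : 'I_m) : admissible d m n ->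
  Yminus F m n d b a = (Yminus_entry b a)%:R.
Proof.
case=> _ _ _ hm hn; rewrite /Yminus /=.
set r1 := size (cind d) in hm *; set r2 := size (rind d) in hn *.
set s := sid d in hm hn *.
have em : (rk d + (r1 + (s + (m - (rk d + r1 + s)))) = m)%N by rewrite !addnA subnKC.
have en : (rk d + (r2 + (s + (n - (rk d + r2 + s)))) = n)%N by rewrite !addnA subnKC.
move: (m - _)%N (n - _)%N em en => m' n' em en {hm hn}.
rewrite (conform_mxE _ _ en em).
set i := cast_ord _ b; set j := cast_ord _ a.
have -> : (b : nat) = i by []. have -> : (a : nat) = j by [].
move: i j => {b a em en} b a.
rewrite /Yminus_entry -/r1 -/r2 -/s.
rewrite mxE; case: (splitP b) => b1 ->; rewrite mxE; case: (splitP a) => a1 ->.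
- exact: Jblock_entry.
- rewrite addKn ltn_add2l mxE; case: (splitP a1) => a2 e; last by rewrite mxE.
  by rewrite /= !mxE e.
- rewrite addKn -addnA !ltn_add2l mxE; case: (splitP b1) => b2 e.
    by rewrite !mxE /= e.
  rewrite mxE e; case: eqP => [e'|_]; last by rewrite andbF.
  by have := ltn_ord a1; lia.
- rewrite -[(rk d + r2 + s)%N]addnA !ltn_add2l mxE.
  case: (splitP b1) => b2 eb; rewrite mxE; case: (splitP a1) => a2 ea; rewrite ?mxE //.
  + rewrite ea eb; case: eqP => [e|_]; last by rewrite andbF.
    by have := ltn_ord a2; lia.
  + rewrite eb ltn_add2l; case: (splitP b2) => b3 eb'; rewrite mxE;
      case: (splitP a2) => a3 ea'.
    * rewrite mxE -val_eqE /=; congr (nat_of_bool _)%:R; have := ltn_ord b3; lia.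
    * rewrite mxE; case: eqP => [e|_]; last by rewrite andbF.
      by have := ltn_ord b3; lia.
    * by rewrite mxE.
    * by rewrite mxE.
Qed.

End RepresentativeEntries.

(** Positions of first occurrences correspond to distinct values. The other positions are the
    repeated columns of C or rows of R. *)
Lemma size_repeats (s : seq nat) :
  size [seq p <- iota 0 (size s) | index (nth 0%N s p) s != p] =
  (size s - size (undup s))%N.
Proof.
pose a p := index (nth 0%N s p) s == p.
suff e : count a (iota 0 (size s)) = size (undup s).
  have h := count_predC a (iota 0 (size s)).
  by rewrite size_iota e in h; rewrite size_filter -{2}h addKn.
rewrite -size_filter -(size_map (nth 0%N s)); apply: perm_size; apply: uniq_perm.
- rewrite map_inj_in_uniq ?filter_uniq ?iota_uniq // => p q.
  by rewrite !mem_filter /a => /andP[/eqP hp _] /andP[/eqP hq _] e; rewrite -hp e.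
- exact: undup_uniq.
move=> x; rewrite mem_undup; apply/mapP/idP => [[p]|xs].
  by rewrite mem_filter mem_iota => /andP[_ /= ps] ->; rewrite mem_nth.
exists (index x s); last by rewrite nth_index.
by rewrite mem_filter mem_iota /= index_mem xs /a nth_index // eqxx.
Qed.

Lemma sumn_mem_undup (A : eqType) (f : A -> nat) (c : seq nat) (ls : seq A) :
  {in ls &, injective f} -> uniq ls -> {subset c <= map f ls} ->
  sumn [seq (f l \in c : nat) | l <- ls] = size (undup c).
Proof.
move=> finj uls sub.
have -> : sumn [seq (f l \in c : nat) | l <- ls] =
          size (map f (filter (fun l => f l \in c) ls)).
  by rewrite size_map size_filter; elim: (ls) => //= l r ->.
apply: perm_size; apply: uniq_perm; rewrite ?undup_uniq //.
  rewrite map_inj_in_uniq ?filter_uniq // => x y; rewrite !mem_filter.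
  by move=> /andP[_ hx] /andP[_ hy]; apply: finj.
move=> x; rewrite mem_undup; apply/mapP/idP => [[l]|xc].
  by rewrite mem_filter => /andP[h _] ->.
have /mapP[l lls e] := sub _ xc; exists l => //.
by rewrite mem_filter -e xc.
Qed.

Lemma map_snd_const (A B : Type) (f : nat -> A) (c : B) (ls : seq nat) :
  map snd [seq (f l, c) | l <- ls] = nseq (size ls) c.
Proof. by elim: ls => //= l ls ->. Qed.

Lemma addn_repeats (u r k i p : nat) : (u <= r)%N -> (k + r + i <= p)%N ->
  (r - u + (p - (k + r + i)) = p - (k + u + i))%N.
Proof. lia. Qed.

(** * An explicit Jordan basis of a representative *)

Section RepresentativeBasis.
Variables (F : fieldType) (m n : nat) (d : datum).
Hypothesis adm : admissible d m n.

Let t := size (ksz d).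
Let r1 := size (cind d).
Let r2 := size (rind d).
Let s := sid d.
Let T := mulr_end (Yrep F m n d).
Let E a : 'rV[F]_(m + n) := row_mx (unit_row F m a) 0.
Let Fv b : 'rV[F]_(m + n) := row_mx 0 (unit_row F n b).
(** Several columns of C may carry the end of the same block, so the block is followed by the sum of
    the corresponding basis vectors, which is empty if there is no such column. *)
Let C l : 'rV[F]_(m + n) :=
  \sum_(p < r1 | nth 0%N (cind d) p == block_end d l) E (rk d + p).

Let k1 : all (leq 1) (ksz d). Proof. by case: adm => /andP[]. Qed.
Let le_m : (rk d + r1 + s <= m)%N. Proof. by case: adm. Qed.
Let le_n : (rk d + r2 + s <= n)%N. Proof. by case: adm. Qed.
Let cind_end p : (p < r1)%N ->
  exists2 l, (l < t)%N & nth 0%N (cind d) p = block_end d l.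
Proof.
case: adm => _ h _ _ _ pr; have /mapP[l] := h _ (mem_nth 0%N pr).
by rewrite mem_iota => lt e; exists l.
Qed.
Let rind_start q : (q < r2)%N ->
  exists2 l, (l < t)%N & nth 0%N (rind d) q = block_start d l.
Proof.
case: adm => _ _ h _ _ qr; have /mapP[l] := h _ (mem_nth 0%N qr).
by rewrite mem_iota => lt e; exists l.
Qed.
Let block_pos_rk l : (l <= t)%N -> (block_pos d l <= rk d)%N.
Proof. exact: leq_block_pos. Qed.

Lemma Yrep_E a : T (E a) = if (a < rk d)%N then Fv a else 0.
Proof.
rewrite /T mulr_endE /Yrep mul_row_block !mulmx0 !mul0mx addr0 addr0.
have [am|am] := ltnP a m; last first.
  rewrite unit_row_oversize // mul0mx row_mx0 ltnNge (leq_trans _ am) //=.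
  by apply: leq_trans le_m; rewrite -addnA leq_addr.
rewrite (unit_row_mul (pid_mx (rk d)) (Ordinal am)).
case: ltnP => ar; last first.
  rewrite (_ : row _ _ = 0) ?row_mx0 //; apply/rowP => j.
  by rewrite !mxE /= [(a < rk d)%N]ltnNge ar andbF.
by congr (row_mx 0 _); apply/rowP => j; rewrite !mxE /= ar andbT eq_sym.
Qed.

Lemma Yrep_F b : (b < n)%N ->
  T (Fv b) = row_mx (\row_(a < m) (Yminus_entry d b a)%:R) 0.
Proof.
move=> bn; rewrite /T mulr_endE /Yrep mul_row_block !mulmx0 !mul0mx add0r addr0.
rewrite (unit_row_mul (Yminus F m n d) (Ordinal bn)); congr (row_mx _ 0); apply/rowP => a.
by rewrite [LHS]mxE Yminus_entryE // mxE.
Qed.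

Lemma Yrep_F_interior l i : (l < t)%N -> (i.+1 < ksize d l)%N ->
  T (Fv (block_pos d l + i)) = E (block_pos d l + i.+1).
Proof.
move=> lt ik.
have h : (block_pos d l + i.+1 < rk d)%N.
  by apply: leq_trans (block_pos_rk lt); rewrite block_posS ltn_add2l.
have bn : (block_pos d l + i < n)%N by lia.
rewrite Yrep_F //; congr (row_mx _ 0); apply/rowP => a; rewrite !mxE.
have nin : (block_pos d l + i).+1 \notin [seq block_end d l | l <- iota 0 t].
  by apply: (@block_interior _ l); rewrite ?block_posS; lia.
rewrite /Yminus_entry nin andbT addnS.
have -> : (block_pos d l + i < rk d)%N by lia.
case: ltnP => ar //; case: ltnP => ar1 /=; last by rewrite gtn_eqF //; lia.
have -> : (a == (block_pos d l + i).+1 :> nat) = false by lia.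
(* An entry of C in this row would make an interior index a block end. *)
case: eqP => // e; have [|l' lt' e'] := @cind_end (a - rk d); first by lia.
by case/mapP: nin; exists l'; [rewrite mem_iota | rewrite e e'].
Qed.

Lemma Yrep_F_last l i : (l < t)%N -> i.+1 = ksize d l ->
  T (Fv (block_pos d l + i)) = C l.
Proof.
move=> lt ik.
have bE : (block_pos d l + i).+1 = block_end d l by rewrite block_endE block_posS -ik addnS.
have h : (block_pos d l + i < rk d)%N.
  by apply: leq_trans (block_pos_rk lt); rewrite bE.
rewrite Yrep_F; last by lia.
have -> : C l = row_mx (\sum_(p < r1 | nth 0%N (cind d) p == block_end d l)
                           unit_row F m (rk d + p)) 0.
  rewrite /C /E; symmetry; apply: (big_morph (fun v => row_mx v 0)).
    by move=> v w; rewrite add_row_mx addr0.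
  exact: row_mx0.
congr (row_mx _ 0); apply/rowP => a; rewrite !mxE summxE.
rewrite /Yminus_entry h bE.
have -> : block_end d l \in [seq block_end d l | l <- iota 0 t].
  by apply: map_f; rewrite mem_iota.
rewrite andbF.
under eq_bigr do rewrite mxE.
case: ltnP => ar.
  by rewrite big1 // => p _; rewrite ltn_eqF //; lia.
case: ltnP => ar1 /=; last first.
  by rewrite big1 // => p _; rewrite gtn_eqF //; have := ltn_ord p; lia.
have pr : (a - rk d < r1)%N by lia.
rewrite big_mkcond (bigD1 (Ordinal pr)) //= subnKC // eqxx big1 ?addr0; last first.
  move=> p; rewrite -val_eqE /= => /eqP np; case: ifP => // _.
  by case: eqP => //; lia.
by rewrite eq_sym; case: eqP.
Qed.

Lemma Yrep_F_rind q : (q < r2)%N ->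
  T (Fv (rk d + q)) = E (nth 0%N (rind d) q).-1.
Proof.
move=> qr; rewrite Yrep_F; last by lia.
congr (row_mx _ 0); apply/rowP => a; rewrite !mxE /Yminus_entry.
rewrite ltnNge leq_addr /= ltn_add2l qr addKn.
have [l lt ->] := rind_start qr; rewrite block_startE /= eqSS.
case: eqP => [->|_]; last by rewrite andbF.
rewrite andbT; have -> // : (block_pos d l < rk d)%N.
by rewrite rk_block_pos; apply: ltn_block_pos.
Qed.

Lemma Yrep_F_sid i : (i < s)%N ->
  T (Fv (rk d + r2 + i)) = E (rk d + r1 + i).
Proof.
move=> qr; rewrite Yrep_F; last by lia.
congr (row_mx _ 0); apply/rowP => a; rewrite !mxE /Yminus_entry -/r1 -/r2 -/s.
rewrite ltnNge -addnA leq_addr /= addnA ltnNge leq_addr /= ltn_add2l qr /=.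
by congr (nat_of_bool _)%:R; lia.
Qed.

Lemma Yrep_F_big b : (rk d + r2 + s <= b)%N -> T (Fv b) = 0.
Proof.
move=> hb; have [bn|bn] := ltnP b n; last first.
  by rewrite /Fv unit_row_oversize // row_mx0 linear0.
rewrite Yrep_F // (_ : \row_a _ = 0) ?row_mx0 //; apply/rowP => a.
rewrite !mxE /Yminus_entry -/r1 -/r2 -/s.
have h1 : (rk d <= b)%N by lia.
have h2 : (rk d + r2 <= b)%N by lia.
by rewrite !ltnNge h1 h2 hb.
Qed.

Lemma Yrep_C l : T (C l) = 0.
Proof.
rewrite /C linear_sum big1 // => p _.
by rewrite [LHS]Yrep_E ltnNge leq_addr.
Qed.

Lemma C_eq0 l : block_end d l \notin cind d -> C l = 0.
Proof.
move=> h; rewrite /C big_pred0 // => p; apply/eqP => e.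
by case/negP: h; rewrite -e mem_nth.
Qed.

Lemma iter_Yrep_block l i : (l < t)%N -> (i < ksize d l)%N ->
  iter i.*2 T (E (block_pos d l)) = E (block_pos d l + i) /\
  iter i.*2.+1 T (E (block_pos d l)) = Fv (block_pos d l + i).
Proof.
move=> lt ik.
have TE j : (j < ksize d l)%N -> T (E (block_pos d l + j)) = Fv (block_pos d l + j).
  move=> jk; rewrite Yrep_E ifT //.
  by apply: leq_trans (block_pos_rk lt); rewrite block_posS ltn_add2l.
elim: i ik => [|i IH] ik.
  by have := TE _ ik; rewrite addn0 /= => ->.
have [_ e] := IH (ltnW ik); rewrite doubleS.
have e2 : iter i.*2.+2 T (E (block_pos d l)) = E (block_pos d l + i.+1).
  by rewrite iterS e Yrep_F_interior.
by split; [exact: e2 | rewrite iterS e2 TE].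
Qed.

Lemma iter_Yrep_block_end l : (l < t)%N ->
  iter (ksize d l).*2 T (E (block_pos d l)) = C l.
Proof.
move=> lt; have : (0 < ksize d l)%N by apply: (allP k1); apply: mem_nth.
case e : (ksize d l) => [|k] // _.
have ke : (k < ksize d l)%N by rewrite e.
have [_ h] := iter_Yrep_block lt ke.
by rewrite doubleS iterS h Yrep_F_last.
Qed.

(** If several rows of R point to the start of the block, the first of them heads the chain. *)
Definition block_gen l : 'rV[F]_(m + n) * (bool * nat) :=
  (if block_start d l \in rind d then Fv (rk d + index (block_start d l) (rind d))
   else E (block_pos d l),
   block_chain (ksize d l, block_end d l \in cind d, block_start d l \in rind d)).

Lemma iter_block_gen l i : (l < t)%N ->
  iter ((block_start d l \in rind d) + i) T (block_gen l).1 =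
  iter i T (E (block_pos d l)).
Proof.
move=> lt; rewrite /block_gen /=; case: ifP => // h.
rewrite add1n iterSr; congr (iter i T _).
by rewrite Yrep_F_rind ?index_mem // nth_index.
Qed.

(** A repeated column of C gives a basis vector killed by [T]. Two rows of R with the same index
    have the same image, so the difference of a repeated row from the first one is killed as well.
    The order of the parts is that of [chain_types]. *)
Definition Yrep_gens : seq ('rV[F]_(m + n) * (bool * nat)) :=
  [seq block_gen l | l <- iota 0 t] ++
  [seq (Fv (rk d + r2 + i), (true, 2)) | i <- iota 0 s] ++
  ([seq (E (rk d + p), (false, 1%N)) |
      p <- iota 0 r1 & index (nth 0%N (cind d) p) (cind d) != p] ++
   [seq (E (rk d + r1 + s + i), (false, 1%N)) | i <- iota 0 (m - (rk d + r1 + s))]) ++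
  ([seq (Fv (rk d + q) - Fv (rk d + index (nth 0%N (rind d) q) (rind d)), (true, 1%N)) |
      q <- iota 0 r2 & index (nth 0%N (rind d) q) (rind d) != q] ++
   [seq (Fv (rk d + r2 + s + i), (true, 1%N)) | i <- iota 0 (n - (rk d + r2 + s))]).

Lemma Yrep_gens_chain : all (chain_gen (@parity_end F m n) T) Yrep_gens.
Proof.
rewrite /Yrep_gens !all_cat !all_map; apply/and4P; split.
- apply/allP => l; rewrite mem_iota /= add0n => lt.
  apply/and3P; split.
  + rewrite /block_gen /=; case: ifP => h; apply/eqP; exact: parity_endE.
  (* The length is run through as the entry of R, the 2k steps that lead to [C l], and a further
     step if C has an entry; without one, [C l] is already zero. *)
  + apply/eqP; rewrite [X in iter X _ _]addnC [LHS]iter_block_gen //=.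
    rewrite [X in iter X _ _]addnC iterD iter_Yrep_block_end //.
    case: (boolP (block_end d l \in cind d)) => h /=; first exact: Yrep_C.
    exact: C_eq0.
  + have : (0 < ksize d l)%N by apply: (allP k1); apply: mem_nth.
    by rewrite /=; lia.
- apply/allP => i; rewrite mem_iota /= add0n => lt; apply/and3P; split=> //=.
    by apply/eqP; exact: parity_endE.
  by rewrite Yrep_F_sid // Yrep_E ltnNge -addnA leq_addr.
- apply/andP; split; apply/allP => i _; apply/and3P; split=> //=.
  + by apply/eqP; exact: parity_endE.
  + by rewrite Yrep_E ltnNge leq_addr.
  + by apply/eqP; exact: parity_endE.
  + by rewrite Yrep_E ltnNge -!addnA leq_addr.
- apply/andP; split; apply/allP => i; last first.
    move=> _; apply/and3P; split=> //=; first by apply/eqP; exact: parity_endE.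
    by rewrite Yrep_F_big // leq_addr.
  rewrite mem_filter mem_iota add0n => /andP[_ /= ir].
  have h : nth 0%N (rind d) i \in rind d by rewrite mem_nth.
  apply/and3P; split=> //=.
    by rewrite linearB /= !parity_endE.
  by rewrite linearB /= !Yrep_F_rind ?index_mem // nth_index // subrr.
Qed.

Lemma sumn_block_c : sumn (map block_c (block_types d)) = size (undup (cind d)).
Proof.
rewrite /block_types -map_comp; apply: sumn_mem_undup; last by case: adm.
  move=> l l'; rewrite !mem_iota /= !add0n => lt lt' e.
  by have [] : l.+1 = l'.+1 by apply: (block_pos_inj k1 _ _ e).
exact: iota_uniq.
Qed.

Lemma sumn_block_r : sumn (map block_r (block_types d)) = size (undup (rind d)).
Proof.
rewrite /block_types -map_comp; apply: sumn_mem_undup; last by case: adm.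
  move=> l l'; rewrite !mem_iota /= !add0n => lt lt' [e].
  by apply: (block_pos_inj k1 _ _ e); rewrite ltnW.
exact: iota_uniq.
Qed.

Lemma Yrep_gens_types : map snd Yrep_gens = chain_types m n (block_types d) s.
Proof.
rewrite /Yrep_gens /chain_types !map_cat !map_snd_const !size_iota -!nseqD.
rewrite !size_repeats block_types_ksize -rk_sumn sumn_block_c sumn_block_r.
have -> : map snd [seq block_gen l | l <- iota 0 t] =
          map block_chain (block_types d) by rewrite /block_types -!map_comp.
by congr (_ ++ (_ ++ (nseq _ _ ++ nseq _ _))); apply: addn_repeats;
  rewrite ?size_undup.
Qed.

Let W := <<chains T Yrep_gens>>%VS.

Let gen_W g i : g \in Yrep_gens -> (i < g.2.2)%N -> iter i T g.1 \in W.
Proof.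
by move=> gg ig; apply: memv_span; apply/chainsP; exists g => //; exists i.
Qed.

Let block_W l i : (l < t)%N -> (i < (ksize d l).*2 + (block_end d l \in cind d))%N ->
  iter i T (E (block_pos d l)) \in W.
Proof.
move=> lt il; rewrite -iter_block_gen //; apply: gen_W.
  by rewrite mem_cat map_f // mem_iota.
by rewrite /block_gen /= addnC ltn_add2r.
Qed.

Lemma block_pos_split a : (a < rk d)%N ->
  exists l i, [/\ (l < t)%N, (i < ksize d l)%N & a = (block_pos d l + i)%N].
Proof.
by move=> ar; have [l [i [lt ik e]]] := tagnat_block_pos (Ordinal ar); exists l, i.
Qed.

Let E_rk_W a : (a < rk d)%N -> E a \in W.
Proof.
move=> /block_pos_split[l [i [lt ik ->]]].
have [<- _] := iter_Yrep_block lt ik; apply: block_W => //.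
by rewrite ltn_addr // ltn_double.
Qed.

Let F_rk_W a : (a < rk d)%N -> Fv a \in W.
Proof.
move=> /block_pos_split[l [i [lt ik ->]]].
have [_ <-] := iter_Yrep_block lt ik; apply: block_W => //.
by rewrite ltn_addr // ltn_Sdouble.
Qed.

Let E_repeat_W p : (p < r1)%N -> index (nth 0%N (cind d) p) (cind d) != p ->
  E (rk d + p) \in W.
Proof.
move=> pr h; apply: (@gen_W (E (rk d + p), (false, 1%N)) 0) => //.
rewrite /Yrep_gens !mem_cat; apply/orP; right; apply/orP; right; apply/orP; left.
apply/orP; left; apply: (map_f (fun p => (E (rk d + p), (false, 1%N)))).
by rewrite mem_filter h mem_iota.
Qed.

(** For a first occurrence, the basis vector is [C l] minus the vectors of the repeated columns,
    which are generators. *)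
Let E_cind_W p : (p < r1)%N -> E (rk d + p) \in W.
Proof.
move=> pr; have [/eqP h|] := boolP (index (nth 0%N (cind d) p) (cind d) == p);
  last exact: E_repeat_W.
have [l lt e] := cind_end pr.
have CW : C l \in W.
  rewrite -iter_Yrep_block_end //; apply: block_W => //.
  by rewrite -e mem_nth // addn1.
move: CW; rewrite /C (bigD1 (Ordinal pr)) /= ?e //.
rewrite rpredDr //; apply: rpred_sum => q /andP[/eqP eq nq]; apply: E_repeat_W => //.
by rewrite eq -e h; apply: contra nq => /eqP; rewrite -val_eqE /= => ->.
Qed.

Lemma E_W a : E a \in W.
Proof.
have [h|h] := ltnP a (rk d); first exact: E_rk_W.
have [h1|h1] := ltnP a (rk d + r1).
  by rewrite -(subnKC h) E_cind_W // -(ltn_add2l (rk d)) subnKC.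
have [h2|h2] := ltnP a (rk d + r1 + s).
  have i0 : (a - (rk d + r1) < s)%N by rewrite -(ltn_add2l (rk d + r1)) subnKC.
  rewrite -(subnKC h1) -Yrep_F_sid //.
  apply: (@gen_W (Fv (rk d + r2 + (a - (rk d + r1))), (true, 2)) 1) => //.
  rewrite /Yrep_gens !mem_cat; apply/orP; right; apply/orP; left.
  by apply: (map_f (fun i => (Fv (rk d + r2 + i), (true, 2)))); rewrite mem_iota.
have [h3|h3] := ltnP a m; last by rewrite /E unit_row_oversize // row_mx0 mem0v.
apply: (@gen_W (E a, (false, 1%N)) 0) => //.
rewrite /Yrep_gens !mem_cat; apply/orP; right; apply/orP; right; apply/orP; left.
apply/orP; right; rewrite -(subnKC h2).
apply: (map_f (fun i => (E (rk d + r1 + s + i), (false, 1%N)))).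
by rewrite mem_iota /= add0n ltn_sub2r // (leq_ltn_trans h2).
Qed.

Let F_first_W x : x \in rind d -> Fv (rk d + index x (rind d)) \in W.
Proof.
move=> xr; have [l lt e] := rind_start (q := index x (rind d)) (etrans (index_mem _ _) xr).
rewrite nth_index // in e; have := xr; rewrite e => sr.
have -> : Fv (rk d + index (block_start d l) (rind d)) = iter 0 T (block_gen l).1.
  by rewrite /block_gen /= sr.
apply: gen_W; last by rewrite /block_gen /= sr addn1.
by rewrite mem_cat map_f // mem_iota.
Qed.

Lemma F_W b : Fv b \in W.
Proof.
have [h|h] := ltnP b (rk d); first exact: F_rk_W.
have [h1|h1] := ltnP b (rk d + r2).
  have qr : (b - rk d < r2)%N by rewrite -(ltn_add2l (rk d)) subnKC.
  rewrite -(subnKC h); set q := (b - rk d)%N in qr *.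
  have xr : nth 0%N (rind d) q \in rind d by rewrite mem_nth.
  have fW := F_first_W xr.
  have [/eqP <- //|nq] := boolP (index (nth 0%N (rind d) q) (rind d) == q).
  rewrite -(subrK (Fv (rk d + index (nth 0%N (rind d) q) (rind d))) (Fv (rk d + q))).
  rewrite rpredD //.
  apply: (@gen_W (Fv (rk d + q) - Fv (rk d + index (nth 0%N (rind d) q) (rind d)), (true, 1%N)) 0) => //.
  rewrite /Yrep_gens !mem_cat; do 3 (apply/orP; right); apply/orP; left.
  apply: (map_f (fun q => (Fv (rk d + q) - Fv (rk d + index (nth 0%N (rind d) q) (rind d)), (true, 1%N)))).
  by rewrite mem_filter nq mem_iota.
have [h2|h2] := ltnP b (rk d + r2 + s).
  rewrite -(subnKC h1).
  apply: (@gen_W (Fv (rk d + r2 + (b - (rk d + r2))), (true, 2)) 0) => //.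
  rewrite /Yrep_gens !mem_cat; apply/orP; right; apply/orP; left.
  apply: (map_f (fun i => (Fv (rk d + r2 + i), (true, 2)))).
  by rewrite mem_iota /= add0n -(ltn_add2l (rk d + r2)) subnKC.
have [h3|h3] := ltnP b n; last by rewrite /Fv unit_row_oversize // row_mx0 mem0v.
apply: (@gen_W (Fv b, (true, 1%N)) 0) => //.
rewrite /Yrep_gens !mem_cat; do 4 (apply/orP; right); rewrite -(subnKC h2).
apply: (map_f (fun i => (Fv (rk d + r2 + s + i), (true, 1%N)))).
by rewrite mem_iota /= add0n ltn_sub2r // (leq_ltn_trans h2).
Qed.

Lemma row_sum_unit_row k (v : 'rV[F]_k) : v = \sum_j v 0 j *: unit_row F k j.
Proof.
apply/rowP => i; rewrite summxE (bigD1 i) //= big1 ?addr0 => [|j ji].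
  by rewrite !mxE eqxx mulr1.
by rewrite !mxE val_eqE eq_sym (negbTE ji) mulr0.
Qed.

(** Independence needs no direct check: the chains contain all [E a] and [Fv b] in their span, and
    their lengths add up to [m + n]. *)
Lemma Yrep_jordan_basis : jordan_basis (@parity_end F m n) T fullv Yrep_gens.
Proof.
split; first exact: Yrep_gens_chain.
rewrite basisEdim; apply/andP; split.
  apply/subvP => v _; rewrite -[v]hsubmxK -[row_mx _ _]addr0.
  have -> : row_mx (lsubmx v) (rsubmx v) + 0 = row_mx (lsubmx v) 0 + row_mx 0 (rsubmx v).
    by rewrite add_row_mx !addr0 add0r.
  rewrite [lsubmx v]row_sum_unit_row [rsubmx v]row_sum_unit_row.
  rewrite (big_morph (fun v => row_mx v 0 : 'rV_(m + n)) (id1 := 0) (op1 := +%R));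
    [|by move=> x y; rewrite add_row_mx addr0|exact: row_mx0].
  rewrite (big_morph (fun v => row_mx 0 v : 'rV_(m + n)) (id1 := 0) (op1 := +%R));
    [|by move=> x y; rewrite add_row_mx addr0|exact: row_mx0].
  rewrite rpredD // rpred_sum // => j _.
    by rewrite -[X in row_mx _ X](scaler0 _ (lsubmx v 0 j)) -scale_row_mx rpredZ ?E_W.
  by rewrite -[X in row_mx X _](scaler0 _ (rsubmx v 0 j)) -scale_row_mx rpredZ ?F_W.
rewrite dimvf dim_matrix [X in (_ <= X)%N]mul1n size_chains (map_comp snd snd) Yrep_gens_types.
rewrite /chain_types !map_cat !sumn_cat !map_nseq !sumn_nseq.
have -> : sumn (map snd (map block_chain (block_types d))) =
  ((rk d).*2 + size (undup (cind d)) + size (undup (rind d)))%N.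
  rewrite rk_sumn -block_types_ksize -sumn_block_c -sumn_block_r.
  elim: (block_types d) => //= x r ->; rewrite /block_ksize /block_c /block_r /=; lia.
rewrite block_types_ksize -rk_sumn sumn_block_c sumn_block_r.
have := size_undup (cind d); have := size_undup (rind d); move: le_m le_n.
rewrite /r1 /r2; move: (size (cind d)) (size (rind d)) (rk d) s.
move: (size (undup (cind d))) (size (undup (rind d))); clear => u1 u2 r1 r2 k s /= h1 h2 h3 h4; lia.
Qed.
End RepresentativeBasis.

(** * Orbits and the nilpotent cone *)

Section EvenGroup.
Variables (F : fieldType) (m n : nat).
Implicit Types g X : 'M[F]_(m + n).

Lemma even_group_unit g : even_group g -> g \in unitmx.
Proof. by case=> A [B [uA uB ->]]; rewrite unitmxE det_ublock unitrM -!unitmxE uA. Qed.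

Lemma even_groupP g : g \in unitmx ->
  even_group g <-> forall p, parity_mx F m n p *m g = g *m parity_mx F m n p.
Proof.
move=> ug; split=> [[A [B [_ _ ->]]] p|h].
  by case: p; rewrite /parity_mx !mulmx_block !mulmx0 !mul0mx !mulmx1 !mul1mx !addr0 ?add0r.
have := h false; move: ug; rewrite -[g]submxK /parity_mx.
rewrite !mulmx_block !mulmx0 !mul0mx !mulmx1 !mul1mx !addr0.
move=> ug /eq_block_mx[_ e1 e2 _]; move: ug; rewrite e1 -e2 => ug.
exists (ulsubmx g), (drsubmx g); move: ug.
move=> ug; suff /andP[uA uB] : (ulsubmx g \in unitmx) && (drsubmx g \in unitmx) by split.
by rewrite !unitmxE -unitrM -(det_ublock _ 0) -unitmxE.
Qed.

Lemma even_group_parity g p v : even_group g ->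
  parity_end F m n p (v *m g) = parity_end F m n p v *m g.
Proof.
move=> eg; rewrite !mulr_endE -!mulmxA; congr (_ *m _); apply/esym.
exact: (even_groupP (even_group_unit eg)).1.
Qed.

Lemma even_group1 : even_group (1%:M : 'M[F]_(m + n)).
Proof. by apply/even_groupP => [|p]; rewrite ?unitmx1 // mulmx1 mul1mx. Qed.

Lemma even_groupM g h : even_group g -> even_group h -> even_group (g *m h).
Proof.
move=> eg eh; have [ug uh] := (even_group_unit eg, even_group_unit eh).
apply/even_groupP => [|p]; first by rewrite unitmx_mul ug.
rewrite mulmxA ((even_groupP ug).1 eg) -mulmxA ((even_groupP uh).1 eh).
by rewrite mulmxA.
Qed.

Lemma even_groupV g : even_group g -> even_group (invmx g).
Proof.
move=> eg; have ug := even_group_unit eg.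
apply/even_groupP => [|p]; first by rewrite unitmx_inv.
apply: (can_inj (mulKmx ug)); rewrite mulmxA -((even_groupP ug).1 eg).
by rewrite -mulmxA mulmxV // mulmx1 mulmxA mulmxV // mul1mx.
Qed.

Lemma adjM g h X : g \in unitmx -> h \in unitmx ->
  adj h (adj g X) = adj (g *m h) X.
Proof.
move=> ug uh; have ugh : g *m h \in unitmx by rewrite unitmx_mul ug.
apply: (can_inj (mulKmx ugh)); rewrite /adj -!mulmxA mulKVmx // mulKVmx //.
by rewrite [RHS]mulmxA [RHS]mulmxA mulmxV // mul1mx.
Qed.

Lemma adj_orbit_refl X : adj_orbit X X.
Proof.
exists 1%:M; first exact: even_group1.
by rewrite /adj invmx1 mul1mx mulmx1.
Qed.

Lemma adj_orbit_eq g X : even_group g -> adj_orbit (adj g X) = adj_orbit X.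
Proof.
move=> eg; have ug := even_group_unit eg; apply/seteqP; split=> _ [h eh <-].
  exists (g *m h); first exact: even_groupM.
  by rewrite adjM // even_group_unit.
exists (invmx g *m h); first by apply: even_groupM => //; exact: even_groupV.
have uh := even_group_unit eh.
by rewrite adjM ?unitmx_mul ?unitmx_inv ?ug // mulmxA mulmxV // mul1mx.
Qed.

Lemma odd_part_adj g X : even_group g -> odd_part X -> odd_part (adj g X).
Proof.
move=> eg /odd_partP ->; have [A [B [_ _ e]]] := even_groupV eg.
have [A' [B' [_ _ e']]] := eg; rewrite /adj e e' !mulmx_block.
rewrite !mulmx0 !mul0mx !addr0 !add0r ?mul0mx ?mulmx0 ?addr0.
by split; rewrite ?block_mxKul ?block_mxKdr.
Qed.

(** Right multiplication by [g] preserves parity and intertwines the actions of X and of g^-1 X g on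
    row vectors. *)
Lemma jordan_basis_adj g X s : even_group g ->
  jordan_basis (parity_end F m n) (mulr_end X) fullv s ->
  exists2 s', jordan_basis (parity_end F m n) (mulr_end (adj g X)) fullv s' &
    map snd s' = map snd s.
Proof.
move=> eg [gs bs]; have ug := even_group_unit eg.
pose s' := [seq (x.1 *m g, x.2) | x <- s].
have iterE i v : iter i (mulr_end (adj g X)) (v *m g) = iter i (mulr_end X) v *m g.
  by elim: i => //= i ->; rewrite !mulr_endE /adj -!mulmxA mulKVmx.
have chE : chains (mulr_end (adj g X)) s' = map (mulr_end g) (chains (mulr_end X) s).
  rewrite /chains map_flatten -!map_comp; congr flatten; apply: eq_map => x /=.
  by rewrite /chain -map_comp; apply: eq_map => i /=; rewrite iterE mulr_endE.
exists s'; last by rewrite /s' -map_comp.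
split.
  rewrite all_map; apply: sub_all gs => x /and3P[/eqP h1 /eqP h2 h3] /=.
  by apply/and3P; split; rewrite //= ?iterE ?h2 ?mul0mx // even_group_parity ?h1.
rewrite chE basisEdim; apply/andP; split.
  rewrite -limg_span (span_basis bs); apply/subvP => v _.
  by rewrite -[v](mulmxKV ug) -mulr_endE memv_img ?memvf.
by rewrite size_map -(eqP (basis_free bs)) (span_basis bs).
Qed.

Lemma jordan_basis_adj_orbit X X' s s' : odd_part X -> odd_part X' ->
  jordan_basis (parity_end F m n) (mulr_end X) fullv s ->
  jordan_basis (parity_end F m n) (mulr_end X') fullv s' ->
  perm_eq (map snd s) (map snd s') ->
  exists2 g, even_group g & adj g X = X'.
Proof.
move=> oX oX' js js' ps.
have [h [hP hT hS]] := jordan_basis_conj (@parity_endD F m n) (@parity_endK F m n)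
  (fun p v => mulr_end_parity p v oX) (fun p v => mulr_end_parity p v oX') js js' ps.
pose g := lin1_mx h.
have gE v : v *m g = h v by exact: mul_rV_lin1.
have ug : g \in unitmx.
  rewrite -row_full_unit -sub1mx; apply/row_subP => i; apply/submxP.
  by have [u <-] := hS (row i 1%:M); exists u; rewrite gE.
exists g.
  apply/even_groupP => // p; apply/row_matrixP => i.
  by rewrite !rowE !mulmxA !gE -!mulr_endE hP.
have e : X *m g = g *m X'.
  by apply/row_matrixP => i; rewrite !rowE !mulmxA !gE -!mulr_endE hT.
by rewrite /adj -mulmxA e mulKmx.
Qed.
End EvenGroup.

(** * Points of the cone are nilpotent *)

Section NilconeNilpotent.
Variables (F : fieldType) (m n : nat).
Let N := (m * n + n * m)%N.

Lemma char_poly_adj (g X : 'M[F]_(m + n)) : g \in unitmx ->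
  char_poly (adj g X) = char_poly X.
Proof.
move=> ug; rewrite /char_poly /char_poly_mx /adj !map_mxM /=.
set G := map_mx polyC g; set G' := map_mx polyC (invmx g).
have G'G : G' *m G = 1%:M by rewrite -map_mxM mulVmx // map_mx1.
have -> : 'X%:M - G' *m map_mx polyC X *m G = G' *m ('X%:M - map_mx polyC X) *m G.
  by rewrite mulmxBr mulmxBl mul_mx_scalar -scalemxAl G'G scalemx1.
by rewrite !det_mulmx mulrC mulrA -det_mulmx (mulmx1C G'G) det1 mul1r.
Qed.

(** With the coordinates of an odd matrix as indeterminates, the coefficients of the characteristic
    polynomial become elements of the polynomial ring in which invariants live. *)
Definition generic_odd_mx : 'M[{mpoly F[N]}]_(m + n) :=
  block_mx 0 (vec_mx (\row_j 'X_(lshift _ j))) (vec_mx (\row_j 'X_(rshift _ j))) 0.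

Lemma generic_odd_mxE (X : 'M[F]_(m + n)) : odd_part X ->
  map_mx (meval (odd_coord X)) generic_odd_mx = X.
Proof.
move=> /odd_partP {2}->; rewrite /generic_odd_mx map_block_mx !map_mx0.
congr block_mx; apply/matrixP => i j; rewrite !mxE mevalXU /odd_coord.
  by rewrite row_mxEl mxvecE !mxE.
by rewrite row_mxEr mxvecE !mxE.
Qed.

Lemma nilcone_char_poly (X : 'M[F]_(m + n)) : nilcone X -> char_poly X = 'X^(m + n).
Proof.
case=> oX nX.
have chE (Z : 'M[F]_(m + n)) k : odd_part Z ->
    ((char_poly generic_odd_mx)`_k).@[odd_coord Z] = (char_poly Z)`_k.
  by move=> oZ; rewrite -coef_map map_char_poly generic_odd_mxE.
have low k : (k < m + n)%N -> (char_poly X)`_k = 0.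
  move=> kN; rewrite -chE //; apply: nX => [g Z eg oZ|].
    by rewrite !chE ?char_poly_adj ?even_group_unit //; apply: odd_part_adj.
  rewrite -coef_map map_char_poly.
  (* The constant term of a coefficient is its value at the zero matrix, whose characteristic
     polynomial is a power of the indeterminate. *)
  have -> : map_mx (mcoeff 0%MM) generic_odd_mx = 0 :> 'M[F]_(m + n).
    rewrite /generic_odd_mx map_block_mx !map_mx0 -[RHS]block_mx0.
    by congr block_mx; apply/matrixP => i j; rewrite !mxE mcoeffX mnm1_eq0.
  by rewrite /char_poly /char_poly_mx map_mx0 subr0 det_scalar coefXn ltn_eqF.
apply/polyP => k; rewrite coefXn; case: (ltngtP k (m + n)) => [/low//|kN|->].
  by rewrite nth_default // size_char_poly.
by have /monicP := char_poly_monic X; rewrite lead_coefE size_char_poly.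
Qed.

Lemma char_poly_nilpotent k (X : 'M[F]_k) (v : 'rV[F]_k) :
  char_poly X = 'X^k -> iter k (mulmxr X) v = 0.
Proof.
(* Cayley-Hamilton is applied in positive size; in size zero the row vector is itself zero. *)
case: k X v => [|k] X v e; first by rewrite /= [v]thinmx0.
have := Cayley_Hamilton X; rewrite e => X0.
suff H i : iter i (mulmxr X) v = v *m horner_mx X 'X^i by rewrite H X0 mulmx0.
elim: i => [|i IH]; first by rewrite expr0 rmorph1 mulmx1.
by rewrite iterS IH exprSr rmorphM /= horner_mx_X -mulmxE mulmxA.
Qed.

Lemma nilcone_jordan_basis (X : 'M[F]_(m + n)) : nilcone X ->
  exists s, jordan_basis (parity_end F m n) (mulr_end X) fullv s.
Proof.
move=> nX; have oX := nX.1.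
apply: (jordan_basis_exists (k := m + n) (@parity_endD F m n) (@parity_endK F m n)).
- by move=> p v; apply: mulr_end_parity.
- exact: subvf.
- by move=> p v _; apply: memvf.
move=> v _; rewrite -(char_poly_nilpotent v (nilcone_char_poly nX)).
by apply: eq_iter => w; rewrite mulr_endE.
Qed.
End NilconeNilpotent.

(** * Matrices with a Jordan basis lie in the cone *)

Section JordanNilcone.
Variables (m n : nat).

(** The same generators serve, since the i-th vector of each chain is only multiplied by the
    non-zero scalar c^i. *)
Lemma jordan_basis_scale (F : fieldType) (X : 'M[F]_(m + n)) c s : c != 0 ->
  jordan_basis (parity_end F m n) (mulr_end X) fullv s ->
  jordan_basis (parity_end F m n) (mulr_end (c *: X)) fullv s.
Proof.
move=> c0 [gs bs].
have iterE i v : iter i (mulr_end (c *: X)) v = c ^+ i *: iter i (mulr_end X) v.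
  elim: i => [|i IH] /=; first by rewrite scale1r.
  by rewrite IH !mulr_endE -scalemxAl -scalemxAr scalerA exprSr.
split.
  apply: sub_all gs => x /and3P[h1 /eqP h2 h3].
  by apply/and3P; split=> //; rewrite iterE h2 scaler0.
rewrite basisEdim; apply/andP; split; last first.
  rewrite size_chains -(size_chains (mulr_end X)).
  by rewrite -(eqP (basis_free bs)) (span_basis bs).
rewrite -(span_basis bs). apply/span_subvP => x /chainsP[g gs0 [i iL ->]].
have ci : c ^+ i != 0 by rewrite expf_neq0.
rewrite -[iter _ _ _](scalerK ci) -iterE rpredZ // memv_span //.
by apply/chainsP; exists g => //; exists i.
Qed.

Lemma odd_partZ (F : fieldType) (X : 'M[F]_(m + n)) c : odd_part X -> odd_part (c *: X).
Proof.
by move=> /odd_partP ->; rewrite scale_block_mx !scaler0; split;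
  rewrite ?block_mxKul ?block_mxKdr.
Qed.

Lemma odd_coordZ (F : fieldType) (X : 'M[F]_(m + n)) c i :
  odd_coord (c *: X) i = c * odd_coord X i.
Proof.
rewrite /odd_coord -[in LHS](submxK X) scale_block_mx block_mxKur block_mxKdl.
by rewrite !linearZ /= -scale_row_mx mxE.
Qed.

(** In characteristic zero the positive integers provide as many distinct non-zero roots of the
    difference as are needed to make it vanish. *)
Lemma poly_const_on_nonzero (F : numFieldType) (q : {poly F}) (a : F) :
  (forall c, c != 0 -> q.[c] = a) -> q.[0] = a.
Proof.
move=> h; suff -> : q = a%:P by rewrite hornerC.
apply/eqP; rewrite -subr_eq0; apply/eqP; set p := q - _.
apply: (@roots_geq_poly_eq0 _ p [seq k.+1%:R | k <- iota 0 (size p)]).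
- apply/allP => _ /seq.mapP[k _ ->].
  by rewrite /root /p hornerD hornerN hornerC h ?subrr // Num.Theory.pnatr_eq0.
- rewrite map_inj_uniq ?iota_uniq // => x y /eqP.
  by rewrite Num.Theory.eqr_nat => /eqP[].
- by rewrite size_map size_iota.
Qed.

(* Over the line through the origin spanned by X, whose non-zero points all lie
   in the orbit of X, an invariant polynomial is constant. *)
Lemma jordan_basis_nilcone (F : numFieldType) (X : 'M[F]_(m + n)) s : odd_part X ->
  jordan_basis (parity_end F m n) (mulr_end X) fullv s -> nilcone X.
Proof.
move=> oX js; split=> // f finv f0.
set v := odd_coord X.
have inv c : c != 0 -> f.@[odd_coord (c *: X)] = f.@[v].
  move=> c0; have [g eg <-] := jordan_basis_adj_orbit oX (odd_partZ c oX) js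
    (jordan_basis_scale c0 js) (perm_refl _).
  exact: finv.
(* [q] is the restriction of [f] to the line through [X], with each monomial turned into a power
   given by its total degree; its value at 0 is the constant term of [f]. *)
pose q := \sum_(k <- msupp f) (f@_k * \prod_i v i ^+ k i) *: 'X^(mdeg k) : {poly F}.
have qE c : q.[c] = f.@[odd_coord (c *: X)].
  rewrite mevalE /q horner_sum; apply: eq_bigr => k _.
  rewrite hornerZ hornerXn -mulrA; congr (_ * _).
  under [RHS]eq_bigr do rewrite odd_coordZ exprMn.
  by rewrite big_split /= prodrXr mdegE mulrC.
have <- : q.[0] = f.@[v] by apply: poly_const_on_nonzero => c c0; rewrite qE inv.
rewrite /q horner_sum big1 // => k _; rewrite hornerZ hornerXn expr0n mdeg_eq0.
by case: eqP => [->|_]; rewrite ?f0 ?mul0r ?mulr0.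
Qed.
End JordanNilcone.

(** * Classification and finiteness of the orbits *)

Section ChainTypeFacts.
Variables (F : fieldType) (m n : nat).

Lemma odd_part_Yrep d : odd_part (Yrep F m n d).
Proof. by split; rewrite ?block_mxKul ?block_mxKdr. Qed.

(** This is read off from the empty datum, whose Jordan basis consists of m and n chains of length 1
    of the two parities. *)
Lemma dim_parity e :
  \dim (parity_end F m n e @: fullv)%VS = if e then n else m.
Proof.
pose d := Datum [::] [::] [::] 0.
have rk0 : rk d = 0%N by rewrite rk_sumn.
have adm : admissible d m n by split=> //=; rewrite rk0.
have js := Yrep_jordan_basis F adm.
have oY := odd_part_Yrep d.
have := dim_iter_proj (@parity_endD F m n) (@parity_endK F m n) e 0
  (fun p v => mulr_end_parity p v oY) js.
rewrite /= => ->; rewrite Yrep_gens_types // /chain_types /=.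
rewrite shifted_count_cat !shifted_count_nseq !subn0.
by case: e; rewrite /shifted_count /= !addn0 ?muln1 ?muln0 ?addn0.
Qed.

Lemma jordan_basis_datum (X : 'M[F]_(m + n)) s : odd_part X ->
  jordan_basis (parity_end F m n) (mulr_end X) fullv s ->
  exists2 d, admissible d m n & adj_orbit X = adj_orbit (Yrep F m n d).
Proof.
move=> oX js.
have cnt e := dim_iter_proj (@parity_endD F m n) (@parity_endK F m n) e 0
  (fun p v => mulr_end_parity p v oX) js.
have [|||d adm pd] := @datum_of_chain_types m n (map snd s).
- by rewrite all_map; apply: sub_all js.1 => x /and3P[].
- by rewrite -cnt /= dim_parity.
- by rewrite -cnt /= dim_parity.
exists d => //; rewrite -(Yrep_gens_types F adm) in pd.
have [g eg <-] := jordan_basis_adj_orbit oX (odd_part_Yrep d) js (Yrep_jordan_basis F adm) pd.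
by rewrite adj_orbit_eq.
Qed.

Lemma Yrep_orbit_eq d d' : admissible d m n -> admissible d' m n ->
  adj_orbit (Yrep F m n d) = adj_orbit (Yrep F m n d') <-> same_up_to_labelling d d'.
Proof.
move=> adm adm'.
have js := Yrep_jordan_basis F adm; have js' := Yrep_jordan_basis F adm'.
have k0 : all (fun x => 0 < block_ksize x)%N (block_types d).
  by apply: block_types_gt0; case: adm => /andP[].
have k0' : all (fun x => 0 < block_ksize x)%N (block_types d').
  by apply: block_types_gt0; case: adm' => /andP[].
rewrite /same_up_to_labelling -(perm_chain_typesE m n _ _ k0 k0').
rewrite -!(Yrep_gens_types F) //; split=> [e|p].
  have [g eg gE] : adj_orbit (Yrep F m n d) (Yrep F m n d').
    by rewrite e; apply: adj_orbit_refl.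
  have [s' js'' <-] := jordan_basis_adj eg js.
  rewrite gE in js''.
  exact: (jordan_basis_types (@parity_endD F m n) (@parity_endK F m n)
    (fun p v => mulr_end_parity p v (odd_part_Yrep d')) js'' js').
have [g eg <-] := jordan_basis_adj_orbit (odd_part_Yrep d) (odd_part_Yrep d') js js' p.
by rewrite adj_orbit_eq.
Qed.

(** The list of chain types fixes the orbit. Its lengths are positive with sum [m + n], so the list
    lies in a finite type of bounded sequences with bounded entries. *)
Lemma finite_nilcone_orbits :
  finite_set [set adj_orbit X | X in @nilcone F m n]%classic.
Proof.
pose N := (m + n)%N.
pose R (b : N.-bseq (bool * 'I_N.+1)) (X : 'M[F]_(m + n)) := odd_part X /\
  exists2 s, jordan_basis (parity_end F m n) (mulr_end X) fullv s &
             map snd s = [seq (x.1, nat_of_ord x.2) | x <- (b : seq (bool * 'I_N.+1))].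
(* The default 0 is taken only when no odd matrix has type [b]; the extra orbit is harmless, as a
   finite superset is enough. *)
pose orb b := adj_orbit (xget 0 (R b)).
apply: (@sub_finite_set _ _ (orb @` [set: N.-bseq (bool * 'I_N.+1)])%classic); last first.
  exact/finite_image/finite_finset.
move=> _ [X nX <-]; have oX := nX.1; have [s js] := nilcone_jordan_basis nX.
have sumL : sumn [seq x.2.2 | x <- s] = N.
  rewrite -(size_chains (mulr_end X)) -(eqP (basis_free js.2)) (span_basis js.2).
  by rewrite dimvf dim_matrix [LHS]mul1n.
have Lle x : x \in s -> (x.2.2 <= N)%N.
  rewrite -sumL; elim: (s) => //= y r IH; rewrite inE => /orP[/eqP->|/IH h].
    exact: leq_addr.
  exact: leq_trans h (leq_addl _ _).
have szs : (size [seq (x.2.1, inord x.2.2 : 'I_N.+1) | x <- s] <= N)%N.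
  rewrite size_map -sumL; have := js.1; elim: (s) => //= y r IH.
  move=> /andP[/and3P[_ _ y0] /IH h]; rewrite -add1n; exact: leq_add.
have RX : R (Bseq szs) X.
  split=> //; exists s => //=; rewrite -map_comp; apply/eq_in_map => x xs /=.
  by rewrite inordK ?ltnS ?Lle // -surjective_pairing.
exists (Bseq szs) => //; rewrite /orb.
have [oX' [s' js' es']] := xgetPex 0 (ex_intro (R (Bseq szs)) X RX).
have [_ [s1 js1 es1]] := RX.
have p : perm_eq (map snd s1) (map snd s') by rewrite es' es1.
have [g eg <-] := jordan_basis_adj_orbit oX oX' js1 js' p.
by rewrite adj_orbit_eq.
Qed.
End ChainTypeFacts.

Local Open Scope classical_set_scope.
Local Open Scope ring_scope.

Theorem theorem3p1p1 (R : realType) (m n : nat) :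
  (* (a) *)
  finite_set [set adj_orbit X | X in @nilcone R[i] m n] /\
  (* (b) *)
  [/\ forall d : datum, admissible d m n -> @nilcone R[i] m n (Yrep R[i] m n d),
      forall X : 'M[R[i]]_(m + n), @nilcone R[i] m n X ->
        exists2 d : datum, admissible d m n & adj_orbit X =
          adj_orbit (Yrep R[i] m n d)
    & forall d d' : datum, admissible d m n -> admissible d' m n ->
        (adj_orbit (Yrep R[i] m n d) = adj_orbit (Yrep R[i] m n d') <->
         same_up_to_labelling d d')].
Proof.
split; first exact: finite_nilcone_orbits.
split=> [d adm|X nX|d d' adm adm'].
- exact: jordan_basis_nilcone (odd_part_Yrep _ _ _ d) (Yrep_jordan_basis _ adm).
- by have [s js] := nilcone_jordan_basis nX; apply: jordan_basis_datum js; case: nX.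
- exact: Yrep_orbit_eq.
Qed.
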